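(* Let $S$ be a commutative Clifford semigroup and let $X$ be any symmetric Banach $\ell^1(S)$-bimodule. Then $H^n(\ell^1(S),X)=0$ for all $n\ge1$.
   Context: A semilattice is a commutative semigroup in which every element is idempotent, ordered by $f\preceq e\iff ef=f$. A Clifford semigroup over a semilattice $L$ is given by groups $(G_e)_{e\in L}$ and group homomorphisms $\varphi_{f,e}:G_e\to G_f$ for $f\preceq e$ with $\varphi_{e,e}=\mathrm{id}$ and $\varphi_{g,f}\varphi_{f,e}=\varphi_{g,e}$; the semigroup is the disjoint union $\coprod_eG_e$ with $x\cdot y=\varphi_{ef,e}(x)\varphi_{ef,f}(y)$ for $x\in G_e$, $y\in G_f$. A bimodule $X$ is symmetric if $a\cdot x=x\cdot a$ for all $a\in\ell^1(S)$, $x\in X$. $H^n$ denotes continuous Hochschild cohomology. *)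

(* Defs.v *)
From HB Require Import structures.
From mathcomp Require Import all_boot all_order all_algebra finmap.
From mathcomp Require Import all_classical all_reals all_analysis.
From mathcomp Require Import complex.

Set Implicit Arguments.
Unset Strict Implicit.
Unset Printing Implicit Defensive.

Import Order.TTheory GRing.Theory Num.Theory numFieldNormedType.Exports.
Local Open Scope ring_scope.
Local Open Scope classical_set_scope.

Record semilattice := Semilattice {
  sl_car :> choiceType;
  sl_op : sl_car -> sl_car -> sl_car;
  sl_opA : forall e f g, sl_op e (sl_op f g) = sl_op (sl_op e f) g;
  sl_opC : forall e f, sl_op e f = sl_op f e;
  sl_opI : forall e, sl_op e e = e }.

Arguments sl_op {_}.
Definition sl_le (L : semilattice) (f e : L) : Prop := sl_op e f = f.

Record group := Group {
  g_car :> choiceType;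
  g_mul : g_car -> g_car -> g_car;
  g_one : g_car;
  g_inv : g_car -> g_car;
  g_mulA : forall x y z, g_mul x (g_mul y z) = g_mul (g_mul x y) z;
  g_mul1x : forall x, g_mul g_one x = x;
  g_mulx1 : forall x, g_mul x g_one = x;
  g_mulVx : forall x, g_mul (g_inv x) x = g_one;
  g_mulxV : forall x, g_mul x (g_inv x) = g_one }.
Arguments g_mul {_}.
Arguments g_inv {_}.

(* Clifford data: a semilattice L, groups (G_e)_{e in L} and group
   homomorphisms phi_{f,e} : G_e -> G_f for f <= e, with phi_{e,e} = id
   and phi_{g,f} o phi_{f,e} = phi_{g,e}.  To avoid proof-dependent
   arguments, cl_phi f e is given for every pair (f,e); only its values
   for f <= e are constrained (and only those are ever used). *)
Record clifford := Clifford {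
  cl_L : semilattice;
  cl_G : cl_L -> group;
  cl_phi : forall f e : cl_L, cl_G e -> cl_G f;
  cl_phi_hom : forall f e, sl_le f e -> forall x y : cl_G e,
      @cl_phi f e (g_mul x y) = g_mul (@cl_phi f e x) (@cl_phi f e y);
  cl_phi_id : forall e (x : cl_G e), @cl_phi e e x = x;
  cl_phi_comp : forall g f e, sl_le g f -> sl_le f e -> forall x : cl_G e,
      @cl_phi g f (@cl_phi f e x) = @cl_phi g e x }.

Arguments cl_phi {_} f e.

Definition cl_S (C : clifford) : choiceType := {e : cl_L C & g_car (cl_G e)}.

Definition cl_mul (C : clifford) (s t : cl_S C) : cl_S C :=
  let e := tag s in let f := tag t in
  Tagged (fun k => g_car (cl_G k)) (g_mul (cl_phi (sl_op e f) e (tagged s))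
                                            (cl_phi (sl_op e f) f (tagged t))).

Definition cl_commutative (C : clifford) : Prop :=
  forall s t : cl_S C, cl_mul s t = cl_mul t s.

Section Sums.
Local Open Scope classical_set_scope.

Definition totally {I : choiceType} : set_system {fset I} :=
  filter_from setT (fun A => [set B | (A `<=` B)%fset]).

Definition partial_sum {I : choiceType} {V : zmodType}
  (x : I -> V) (A : {fset I}) : V := \sum_(i : A) x (val i).

End Sums.

(* Elements are represented by functions S -> C satisfying [l1].       *)
Section L1.
Variable R : realType.
Local Notation C := (R[i]).
Variable S : choiceType.
Variable mul : S -> S -> S.

Definition l1 (a : S -> C) : Prop :=
  exists M : R, forall A : {fset S}, partial_sum (fun s => ComplexField.Normc.normc (a s)) A <= M.

Definition l1norm (a : S -> C) : R :=
  sup [set partial_sum (fun s => ComplexField.Normc.normc (a s)) A | A in [set: {fset S}]].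

Definition csum (I : choiceType) (x : I -> C) : C :=
  lim (@partial_sum I (C^o) x @ totally).

Definition conv (a b : S -> C) : S -> C :=
  fun u => csum (fun p : S * S => if mul p.1 p.2 == u then a p.1 * b p.2 else 0).

End L1.

Section Hochschild.
Variable R : realType.
Local Notation C := (R[i]).
Variable S : choiceType.
Variable mul : S -> S -> S.
Local Notation A := (S -> C).
Local Notation l1 := (@l1 R S).
Local Notation l1norm := (@l1norm R S).
Local Notation conv := (@conv R S mul).
Variable X : completeNormedModType C.
Variable actl : A -> X -> X.
Variable actr : X -> A -> X.

Definition banach_bimodule : Prop :=
  [/\ (forall a b x, l1 a -> l1 b -> actl (conv a b) x = actl a (actl b x)),
      (forall a b x, l1 a -> l1 b -> actr x (conv a b) = actr (actr x a) b),
      (forall a b x, l1 a -> l1 b -> actr (actl a x) b = actl a (actr x b))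
   & [/\ 
      (forall a, l1 a -> forall (l : C) x y,
          actl a (l *: x + y) = l *: actl a x + actl a y
       /\ actr (l *: x + y) a = l *: actr x a + actr y a),
      (forall x (l : C) a b, l1 a -> l1 b ->
          actl (fun s => l * a s + b s) x = l *: actl a x + actl b x
       /\ actr x (fun s => l * a s + b s) = l *: actr x a + actr x b)
    & exists c : R, forall a x, l1 a ->
          `|actl a x| <= (c * l1norm a)%:C%C * `|x|
       /\ `|actr x a| <= (c * l1norm a)%:C%C * `|x| ] ].

Definition symmetric_bimodule : Prop :=
  forall a x, l1 a -> actl a x = actr x a.

(* n-cochains: maps T : A^n -> X; only their values on l^1 arguments
   matter.  [cochain n T]: T is bounded and n-linear on l^1(S)^n. *)
Definition l1_args n (a : 'I_n -> A) : Prop := forall i, l1 (a i).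

Definition cochain n (T : ('I_n -> A) -> X) : Prop :=
  (forall (a : 'I_n -> A) (i : 'I_n) (b : A) (l : C),
      l1_args a -> l1 b ->
      T (fun j => if j == i then (fun s => l * a i s + b s) else a j)
      = l *: T a + T (fun j => if j == i then b else a j))
  /\ exists c : R, forall a : 'I_n -> A, l1_args a ->
      `|T a| <= (c * \prod_(i < n) l1norm (a i))%:C%C.

(* arguments (a_1, ..., a_{n+1}) are  a : 'I_n.+1 -> A  (0-indexed) *)
Definition args_tail n (a : 'I_n.+1 -> A) : 'I_n -> A :=
  fun j => a (lift ord0 j).
Definition args_init n (a : 'I_n.+1 -> A) : 'I_n -> A :=
  fun j => a (widen_ord (leqnSn n) j).
(* (a_1, ..., a_{i} a_{i+1}, ..., a_{n+1}), merging positions i, i+1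
   (0-indexed, i < n) *)
Definition args_merge n (a : 'I_n.+1 -> A) (i : nat) : 'I_n -> A :=
  fun j => if (j < i)%N then a (inord j)
           else if j == i :> nat then conv (a (inord i)) (a (inord i.+1))
           else a (inord j.+1).

Definition coboundary n (T : ('I_n -> A) -> X) : ('I_n.+1 -> A) -> X :=
  fun a => actl (a ord0) (T (args_tail a))
         + \sum_(i < n) (-1) ^+ i.+1 *: T (args_merge a i)
         + (-1) ^+ n.+1 *: actr (T (args_init a)) (a ord_max).

Definition hochschild_vanishes (n : nat) : Prop :=
  forall T : ('I_n.+1 -> A) -> X,
    cochain T ->
    (forall a : 'I_n.+2 -> A, l1_args a -> coboundary T a = 0) ->
    exists U : ('I_n -> A) -> X,
      cochain U /\ forall a : 'I_n.+1 -> A, l1_args a -> coboundary U a = T a.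

End Hochschild.

(* Main.v *)
(* Since l^1(S) is spanned by point masses, a bounded n-cochain is a bounded
   function on S^n.  If f is a bounded (n+1)-cocycle and D = sum x (x) y is an
   element of l^1(S u {1}) (x) l^1(S u {1}) with sum xy = 1 and a D = D a, then,
   because the coefficients are symmetric, (K f)(a) = sum y f(x, a) satisfies
   K d + d K = id.  For the subsemigroup lying over a finite set of idempotents
   such a D exists approximately: decompose 1 into the orthogonal idempotents
   E generated by the finite set and average h E (x) h^-1 E over a Folner box
   of the abelian group attached to E.  The norm of D grows with the number of
   idempotents, so D cannot be chosen once for the whole semigroup.  As in the
   method of acyclic models, one instead defines a homotopy s tuple by tuple,
   using at b = (b_1, .., b_n) only the idempotents of the b_i:
   s(b) = K_b (b - s (d b)).  Its norm is bounded in terms of n alone and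
   s d + d s = id up to an arbitrarily small uniform error.  Hence every
   cocycle of norm M is within M/2 of the coboundary of a cochain of norm at
   most C M; iterating and summing the series in X gives an exact primitive,
   without any duality assumption on X. *)

Require Import Defs.
From HB Require Import structures.
From mathcomp Require Import all_boot all_order all_algebra finmap.
From mathcomp Require Import all_classical all_reals all_analysis.
From mathcomp Require Import complex ring lra.

Set Implicit Arguments.
Unset Strict Implicit.
Unset Printing Implicit Defensive.

Import Order.TTheory GRing.Theory Num.Theory numFieldNormedType.Exports.
Local Open Scope ring_scope.

Local Notation normc := ComplexField.Normc.normc.

(** * The real-valued norm on a normed module over [R[i]] *)

Section RealNorm.
Variables (R : realType) (X : normedModType R[i]).
Implicit Types x y : X.

(** The norm takes values in [R[i]], whose order is only partial. Its real part loses nothing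
    ([nrmE]) and gives access to real estimates and suprema. *)
Definition nrm x : R := complex.Re `|x|.

Lemma nrmE x : `|x| = (nrm x)%:C%C.
Proof. by rewrite /nrm RRe_real ?normr_real. Qed.

Lemma nrm_ge0 x : 0 <= nrm x.
Proof. by rewrite -lecR -nrmE normr_ge0. Qed.

Lemma nrm0 : nrm 0 = 0.
Proof. by rewrite /nrm normr0. Qed.

Lemma nrm0_eq0 x : nrm x = 0 -> x = 0.
Proof. by move=> x0; apply/eqP; rewrite -normr_eq0 nrmE x0. Qed.

Lemma nrmN x : nrm (- x) = nrm x.
Proof. by rewrite /nrm normrN. Qed.

Lemma nrmD x y : nrm (x + y) <= nrm x + nrm y.
Proof. by rewrite -lecR rmorphD /= -!nrmE ler_normD. Qed.

Lemma nrmB x y : nrm (x - y) <= nrm x + nrm y.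
Proof. by rewrite -[nrm y]nrmN nrmD. Qed.

Lemma nrmZ (l : R[i]) x : nrm (l *: x) = normc l * nrm x.
Proof.
have : (nrm (l *: x))%:C%C = (normc l * nrm x)%:C%C :> R[i].
  by rewrite rmorphM /= -!nrmE normrZ.
by case.
Qed.

Lemma nrm_sum I (r : seq I) (P : pred I) (F : I -> X) :
  nrm (\sum_(i <- r | P i) F i) <= \sum_(i <- r | P i) nrm (F i).
Proof.
elim/big_rec2: _ => [|i a x _ le_xa]; first by rewrite nrm0.
by rewrite (le_trans (nrmD _ _)) // lerD2l.
Qed.

Lemma nrm_le0_eq0 x : nrm x <= 0 -> x = 0.
Proof. by move=> x0; apply: nrm0_eq0; apply/le_anti; rewrite x0 nrm_ge0. Qed.

End RealNorm.

Lemma normc_ge0 (R : rcfType) (l : R[i]) : 0 <= normc l.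
Proof. by case: l => a b; rewrite sqrtr_ge0. Qed.

Lemma normc_natV (R : rcfType) (N : nat) : normc (N%:R^-1 : R[i]) = N%:R^-1.
Proof.
have -> : (N%:R^-1 : R[i]) = (N%:R^-1)%:C%C by rewrite fmorphV rmorph_nat.
by rewrite /normc /= expr0n addr0 sqrtr_sqr ger0_norm // invr_ge0.
Qed.

Lemma normcN1 (R : rcfType) : normc (-1 : R[i]) = 1.
Proof. by rewrite /normc /= oppr0 expr0n addr0 sqrrN expr1n sqrtr1. Qed.

(** * The Hochschild coboundary on sequences *)

Section Coboundary.
Variables (S : Type) (mul : S -> S -> S) (X : zmodType) (act : S -> X -> X).
Implicit Types (f : seq S -> X) (a : seq S).

(* [rcob f] collects, up to a global sign, every face of the Hochschild
   coboundary except the first one. *)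
Fixpoint rcob f a : X :=
  if a is x :: a' then
    if a' is y :: l then f (mul x y :: l) - rcob (fun m => f (x :: m)) a'
    else act x (f [::])
  else 0.

(** The last face acts on the left, which is the Hochschild coboundary only for symmetric
    coefficients. A single function on sequences of every length carries all degrees at once; the
    value at the empty sequence is a default. *)
Definition cob f a : X :=
  if a is x :: l then act x (f l) - rcob f a else 0.

Lemma rcob_cons2 f x y l :
  rcob f [:: x, y & l] = f (mul x y :: l) - rcob (fun m => f (x :: m)) (y :: l).
Proof. by []. Qed.

Lemma cob_seq1 f x : cob f [:: x] = 0.
Proof. exact: subrr. Qed.

Lemma eq_rcob f g a : (forall m, size m = (size a).-1 -> f m = g m) ->
  rcob f a = rcob g a.
Proof.
elim: a f g => [//|x [|y l] IHl] f g eq_fg; first by rewrite /= eq_fg.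
rewrite !rcob_cons2 eq_fg //; congr (_ - _).
by apply: IHl => m /= sz_m; apply: eq_fg; rewrite /= sz_m.
Qed.

Lemma eq_cob f g a : (forall m, size m = (size a).-1 -> f m = g m) ->
  cob f a = cob g a.
Proof.
by case: a => [//|x l] eq_fg; rewrite /cob eq_fg //; congr (_ - _); apply: eq_rcob.
Qed.

End Coboundary.

Lemma rcob_map (S T : Type) (mulS : S -> S -> S) (mulT : T -> T -> T)
    (X : zmodType) (actS : S -> X -> X) (actT : T -> X -> X) (h : S -> T) :
  (forall s t, h (mulS s t) = mulT (h s) (h t)) ->
  (forall s x, actS s x = actT (h s) x) ->
  forall f a, rcob mulS actS (fun m => f (map h m)) a = rcob mulT actT f (map h a).
Proof.
move=> hM hA f a; elim: a f => [//|x [|y l] IHl] f; first by rewrite /= hA.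
rewrite 2!map_cons !rcob_cons2 -hM; congr (_ - _).
exact: (IHl (fun m => f (h x :: m))).
Qed.

(** Naturality of the coboundary, meant for the embedding of [S] into l^1 by point masses. *)
Lemma cob_map (S T : Type) (mulS : S -> S -> S) (mulT : T -> T -> T)
    (X : zmodType) (actS : S -> X -> X) (actT : T -> X -> X) (h : S -> T) :
  (forall s t, h (mulS s t) = mulT (h s) (h t)) ->
  (forall s x, actS s x = actT (h s) x) ->
  forall f a, cob mulS actS (fun m => f (map h m)) a = cob mulT actT f (map h a).
Proof.
move=> hM hA f [//|x l].
by rewrite /cob (rcob_map hM hA) /= hA.
Qed.

Section CoboundaryLinear.
Variables (S : Type) (mul : S -> S -> S) (K : pzRingType) (X : lmodType K).
Variable act : S -> X -> X.
Implicit Types (f : seq S -> X) (a : seq S).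
Hypothesis act_lin : forall s (l : K) x y, act s (l *: x + y) = l *: act s x + act s y.

Local Notation rcob := (rcob mul act).
Local Notation cob := (cob mul act).

Lemma act0 s : act s 0 = 0.
Proof. by have := act_lin s (-1) 0 0; rewrite !scaleN1r addNr addNr. Qed.

Lemma actZ s l x : act s (l *: x) = l *: act s x.
Proof. by rewrite -[l *: x]addr0 act_lin act0 addr0. Qed.

Lemma actD s x y : act s (x + y) = act s x + act s y.
Proof. by rewrite -[x]scale1r act_lin !scale1r. Qed.

Lemma actB s x y : act s (x - y) = act s x - act s y.
Proof. by rewrite actD -scaleN1r actZ scaleN1r. Qed.

Lemma rcob_lin l f g a : rcob (fun m => l *: f m + g m) a = l *: rcob f a + rcob g a.
Proof.
elim: a f g => [|x [|y m] IHm] f g; first by rewrite /= scaler0 addr0.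
  by rewrite /= act_lin.
rewrite !rcob_cons2 IHm scalerBr opprD !addrA; congr (_ - _).
by rewrite -!addrA; congr (_ + _); rewrite addrC.
Qed.

Lemma cob_lin l f g a : cob (fun m => l *: f m + g m) a = l *: cob f a + cob g a.
Proof.
case: a => [|x m]; first by rewrite /= scaler0 addr0.
rewrite /cob rcob_lin act_lin scalerBr opprD !addrA; congr (_ - _).
by rewrite -!addrA; congr (_ + _); rewrite addrC.
Qed.

Lemma cobB f g a : cob (fun m => f m - g m) a = cob f a - cob g a.
Proof.
rewrite addrC -scaleN1r -cob_lin; apply: eq_cob => m _.
by rewrite scaleN1r addrC.
Qed.

Lemma rcob0 a : rcob (fun=> 0) a = 0.
Proof.
rewrite -[RHS](addNr (rcob (fun=> 0) a)) -scaleN1r -rcob_lin; apply: eq_rcob => m _.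
by rewrite scaler0 addr0.
Qed.

Lemma rcobB f g a : rcob (fun m => f m - g m) a = rcob f a - rcob g a.
Proof.
rewrite addrC -scaleN1r -rcob_lin; apply: eq_rcob => m _.
by rewrite scaleN1r addrC.
Qed.

Lemma rcobD f g a : rcob (fun m => f m + g m) a = rcob f a + rcob g a.
Proof.
rewrite -[rcob f a]scale1r -rcob_lin; apply: eq_rcob => m _.
by rewrite scale1r.
Qed.

Hypothesis mulA : associative mul.
Hypothesis mulC : commutative mul.
Hypothesis actM : forall s t x, act (mul s t) x = act s (act t x).

Lemma actC s t x : act s (act t x) = act t (act s x).
Proof. by rewrite -!actM mulC. Qed.

(** The last face acts on the coefficient, so [s] must commute with that action; commutativity of
    [mul] enters here. *)
Lemma rcob_act s f a : rcob (fun m => act s (f m)) a = act s (rcob f a).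
Proof.
elim: a f => [|x [|y m] IHm] f; first by rewrite /= act0.
  by rewrite /= actC.
by rewrite !rcob_cons2 IHm actB.
Qed.

Let cob_cons2 f x y m :
  cob f [:: x, y & m] = act x (f (y :: m)) - f (mul x y :: m)
    + act y (f (x :: m)) - cob (fun m => f (x :: m)) (y :: m).
Proof.
rewrite /cob rcob_cons2 !opprB [_ (y :: m) - act y _]addrC.
by rewrite [RHS]addrA addrK addrA addrAC.
Qed.

(** This is d d = 0 with the first outer face moved to the other side. Expanding [cob f (x :: m)] by
    [cob_cons2] produces the coboundary of the partial application of [f] to [x]; the induction
    hypothesis evaluates it, and it cancels the contribution of [g2]. *)
Lemma rcob_cob f x y l : rcob (cob f) [:: x, y & l] = act x (cob f (y :: l)).
Proof.
elim: l f x y => [|z l IHl] f x y.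
  by rewrite rcob_cons2 !cob_seq1 sub0r /= -/(cob f [:: x]) cob_seq1 act0 oppr0 act0.
rewrite rcob_cons2.
(* Two faces from [cob_cons2]: [x] multiplied into the next entry, and the next entry acting. Both
   are evaluated at nonempty tuples only, so [0] is a mere default. *)
pose g1 m := if m is t :: n then f (mul x t :: n) else 0.
pose g2 m := if m is t :: n then act t (f (x :: n)) else 0.
have -> : rcob (fun m => cob f (x :: m)) [:: y, z & l] =
    rcob (fun m => act x (f m) - g1 m + g2 m - cob (fun m => f (x :: m)) m)
         [:: y, z & l].
  by apply: eq_rcob => -[//|t m] _; rewrite cob_cons2.
rewrite rcobB rcobD rcobB IHl rcob_act.
have -> : rcob g1 [:: y, z & l] = rcob f [:: mul x y, z & l].
  by rewrite !rcob_cons2 /= -mulA; congr (_ - _); apply: eq_rcob => -[].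
have -> : rcob g2 [:: y, z & l] = act y (cob (fun m => f (x :: m)) (z :: l)).
  rewrite rcob_cons2 /g2 actM /cob actB; congr (_ - _).
  by rewrite -rcob_act; apply: eq_rcob.
by rewrite addrK /cob actM opprB addrA subrK -actB.
Qed.

Lemma cob_cob f a : cob (cob f) a = 0.
Proof.
case: a => [//|x [|y l]]; first exact: cob_seq1.
by apply/eqP; rewrite subr_eq0 rcob_cob.
Qed.

End CoboundaryLinear.

(** * Faces of a tuple and norm estimates for the coboundary *)

Section Faces.
Variables (S : eqType) (mul : S -> S -> S).
Implicit Types a : seq S.

(** The tuples at which [rcob] reads its cochain, without signs and actions: all that support and
    norm estimates require. *)
Fixpoint rfaces a : seq (seq S) :=
  if a is x :: a' then
    if a' is y :: l then (mul x y :: l) :: map (cons x) (rfaces a') else [:: [::]]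
  else [::].

Definition faces a := if a is x :: l then l :: rfaces a else [::].

Lemma rfaces_cons2 x y l :
  rfaces [:: x, y & l] = (mul x y :: l) :: map (cons x) (rfaces (y :: l)).
Proof. by []. Qed.

Lemma size_faces a m : m \in faces a -> size m = (size a).-1.
Proof.
case: a => [//|x l]; rewrite inE => /orP[/eqP->//|].
elim: l x m => [|y l IHl] x m; first by rewrite inE => /eqP ->.
rewrite rfaces_cons2 inE => /orP[/eqP->//|/mapP[n n_f ->]].
by rewrite /= (IHl _ _ n_f).
Qed.

Lemma mem_faces (P : S -> Prop) a :
  (forall x y, P x -> P y -> P (mul x y)) -> {in a, forall x, P x} ->
  {in faces a, forall m, {in m, forall x, P x}}.
Proof.
move=> PM; case: a => [//|x l] Pa m; rewrite inE => /orP[/eqP->|].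
  by move=> y yl; apply: Pa; rewrite inE yl orbT.
elim: l x Pa m => [|y l IHl] x Pa m; first by rewrite inE => /eqP ->.
rewrite rfaces_cons2 inE => /orP[/eqP-> z|/mapP[n n_f ->] z].
  rewrite inE => /orP[/eqP->|zl]; last by apply: Pa; rewrite !inE zl !orbT.
  by apply: PM; apply: Pa; rewrite !inE eqxx ?orbT.
rewrite inE => /orP[/eqP->|]; first by apply: Pa; rewrite inE eqxx.
by apply: (IHl y) => // t tl; apply: Pa; rewrite inE tl orbT.
Qed.

Variables (R : realType) (X : normedModType R[i]) (act : S -> X -> X) (c : R).
Hypothesis c_ge1 : 1 <= c.
Hypothesis act_bound : forall s x, nrm (act s x) <= c * nrm x.

Lemma nrm_rcob f a M : 0 <= M -> {in rfaces a, forall m, nrm (f m) <= M} ->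
  nrm (rcob mul act f a) <= (size a)%:R * (c * M).
Proof.
move=> M_ge0; have c_ge0 : 0 <= c by rewrite (le_trans ler01).
elim: a f => [|x [|y l] IHl] f fM; first by rewrite nrm0 mul0r.
  by rewrite /= mul1r (le_trans (act_bound _ _)) // ler_wpM2l // fM ?inE.
rewrite rcob_cons2 (le_trans (nrmB _ _)) // mulrSr mulrDl mul1r [leRHS]addrC.
apply: lerD.
  rewrite (@le_trans _ _ M) ?ler_peMl // fM // rfaces_cons2 inE eqxx //.
apply: IHl => m mf; apply: fM.
by rewrite rfaces_cons2 inE map_f ?orbT.
Qed.

(** There is one summand per face; [1 <= c] lets each be charged [c * M], including those on which
    nothing acts. *)
Lemma nrm_cob f a M : 0 <= M -> {in faces a, forall m, nrm (f m) <= M} ->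
  nrm (cob mul act f a) <= (size a).+1%:R * (c * M).
Proof.
move=> M_ge0; have c_ge0 : 0 <= c by rewrite (le_trans ler01).
case: a => [|x l] fM; first by rewrite nrm0 !mulr_ge0.
rewrite (le_trans (nrmB _ _)) // mulrSr mulrDl mul1r [leRHS]addrC.
apply: lerD.
  by rewrite (le_trans (act_bound _ _)) // ler_wpM2l // fM ?inE ?eqxx.
by apply: nrm_rcob => // m mf; apply: fM; rewrite inE mf orbT.
Qed.

End Faces.

(** * Approximate diagonals *)

Section Combinations.
Variables (R : realType) (X : normedModType R[i]) (I : eqType).
Implicit Types (W : seq (R[i] * (I * I))) (g : I -> I -> X).

(* A list of weighted pairs stands for a finitely supported element of
   l^1(I x I). *)
Definition lev W g : X := \sum_(w <- W) w.1 *: g w.2.1 w.2.2.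
Definition lnorm W : R := \sum_(w <- W) normc w.1.
Definition lscale (c : R[i]) (h k : I -> I) W :=
  [seq (c * w.1, (h w.2.1, k w.2.2)) | w <- W].

Lemma lev_cat W1 W2 g : lev (W1 ++ W2) g = lev W1 g + lev W2 g.
Proof. by rewrite /lev big_cat. Qed.

Lemma lnorm_cat W1 W2 : lnorm (W1 ++ W2) = lnorm W1 + lnorm W2.
Proof. by rewrite /lnorm big_cat. Qed.

Lemma lev_scale c h k W g :
  lev (lscale c h k W) g = c *: lev W (fun x y => g (h x) (k y)).
Proof.
by rewrite /lev big_map scaler_sumr; apply: eq_bigr => w _; rewrite scalerA.
Qed.

Lemma lnorm_scale c h k W : lnorm (lscale c h k W) = normc c * lnorm W.
Proof.
rewrite /lnorm big_map mulr_sumr; apply: eq_bigr => w _.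
exact: ComplexField.Normc.normcM.
Qed.

Lemma eq_lev W g g' :
  {in W, forall w, g w.2.1 w.2.2 = g' w.2.1 w.2.2} -> lev W g = lev W g'.
Proof. by move=> eq_g; apply: eq_big_seq => w wW; rewrite eq_g. Qed.

Lemma levB W g g' : lev W (fun x y => g x y - g' x y) = lev W g - lev W g'.
Proof.
by rewrite /lev -sumrB; apply: eq_bigr => w _; rewrite scalerBr.
Qed.

Lemma levD W g g' : lev W (fun x y => g x y + g' x y) = lev W g + lev W g'.
Proof.
by rewrite /lev -big_split; apply: eq_bigr => w _; rewrite scalerDr.
Qed.

Lemma lev0 W : lev W (fun _ _ => 0) = 0.
Proof. by rewrite /lev big1 // => w _; rewrite scaler0. Qed.

Lemma nrm_lev W g M : {in W, forall w, nrm (g w.2.1 w.2.2) <= M} ->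
  nrm (lev W g) <= lnorm W * M.
Proof.
move=> gM; rewrite (le_trans (nrm_sum _ _ _)) // /lnorm mulr_suml.
rewrite big_seq [leRHS]big_seq; apply: ler_sum => w wW.
by rewrite nrmZ ler_wpM2l ?normc_ge0 ?gM.
Qed.

End Combinations.

(** * Adjoining a unit, represented by [None] *)

Section OptionMonoid.
Variables (S : Type) (mul : S -> S -> S).

Definition omul (x y : option S) : option S :=
  match x, y with
  | None, _ => y
  | _, None => x
  | Some s, Some t => Some (mul s t)
  end.

Lemma omulE s t : omul (Some s) (Some t) = Some (mul s t).
Proof. by []. Qed.

Lemma omulA : associative mul -> associative omul.
Proof. by move=> mulA [x|] [y|] [z|] //=; rewrite mulA. Qed.

Lemma omulC : commutative mul -> commutative omul.
Proof. by move=> mulC [x|] [y|] //=; rewrite mulC. Qed.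

End OptionMonoid.
Arguments omul : simpl never.

Section ApproximateDiagonal.
Variables (S : eqType) (mul : S -> S -> S) (idem inv : S -> S).
Hypothesis mulA : associative mul.
Hypothesis mulC : commutative mul.
Hypothesis mul_inv : forall x, mul x (inv x) = idem x.

Local Notation M := (option S).
Local Notation "x ** y" := (omul mul x y) (at level 40, left associativity).

Let oA : associative (omul mul) := omulA mulA.
Let oC : commutative (omul mul) := omulC mulC.
Let oCA (x y z : M) : x ** (y ** z) = y ** (x ** z).
Proof. by rewrite !oA [x ** y]oC. Qed.

Variables (R : realType) (X : normedModType R[i]).

(* Averaging over the box of all [prod_i q_i ^ k_i], [0 <= k_i < N], is
   invariant up to O(1/N) under each [q_i]. *)
Lemma folner_diagonal (e : M) (Q : seq S) (N : nat) (P : M -> Prop) :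
  e ** e = e -> {in Q, forall q, Some (idem q) ** e = e} -> (0 < N)%N ->
  P e -> {in Q, forall q, forall x, P x -> P (Some q ** x)} ->
  exists W : seq (R[i] * (M * M)),
  [/\ lnorm W <= 1,
      {in W, forall w, e ** w.2.2 = w.2.2 /\ P w.2.1},
      forall k : M -> X, lev W (fun x y => k (x ** y)) = k e &
      {in Q, forall q, forall (g : M -> M -> X) B,
        (forall x y, nrm (g x y) <= B) ->
        nrm (lev W (fun x y => g (Some q ** x) y - g x (Some q ** y)))
          <= 2 * B / N%:R}].
Proof.
move=> ee + N_gt0 Pe; elim: Q => [|q Q IHQ] Qe PQ.
  exists [:: (1, (e, e))]; split=> //.
  - by rewrite /lnorm big_seq1 ComplexField.Normc.normc1.
  - by move=> w; rewrite inE => /eqP ->.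
  - by move=> k; rewrite /lev big_seq1 /= ee scale1r.
case: IHQ => [q' q'Q|q' q'Q|W0 [W0_norm W0_supp W0_prod W0_inv]].
- by apply: Qe; rewrite inE q'Q orbT.
- by apply: PQ; rewrite inE q'Q orbT.
(* [h k] and [h' k] multiply by the k-th powers of [q] and [inv q]; [W] averages over 0 <= k < N
   their simultaneous action on the two legs of [W0]. *)
pose h k := iter k (omul mul (Some q)).
pose h' k := iter k (omul mul (Some (inv q))).
pose W := flatten [seq lscale (N%:R^-1) (h k) (h' k) W0 | k <- iota 0 N].
have levW g : lev W g =
    N%:R^-1 *: \sum_(0 <= k < N) lev W0 (fun x y => g (h k x) (h' k y)).
  rewrite /lev big_flatten big_map scaler_sumr /index_iota subn0.
  by apply: eq_bigr => k _; rewrite -/(lev _ g) lev_scale.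
have N_neq0 : N%:R != 0 :> R[i] by rewrite pnatr_eq0 -lt0n.
have N_gt0R : 0 < N%:R :> R by rewrite ltr0n.
have qe : Some (idem q) ** e = e by apply: Qe; rewrite inE eqxx.
have hS k x : h k.+1 x = Some q ** h k x by [].
have h'S k x : h' k.+1 x = Some (inv q) ** h' k x by [].
have comm_h z k x : z ** h k x = h k (z ** x).
  by elim: k => // k IHk; rewrite !hS oCA IHk.
have comm_h' z k x : z ** h' k x = h' k (z ** x).
  by elim: k => // k IHk; rewrite !h'S oCA IHk.
(* [inv q] undoes [q] only where [idem q] acts as the identity, in particular on elements fixed by
   [e]. Hence the condition carried on second legs. *)
have qq'K y : e ** y = y -> Some q ** (Some (inv q) ** y) = y.
  move=> <-; rewrite oA omulE mul_inv oA.
  by rewrite qe.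
have hh'K k z : e ** z = z -> h k (h' k z) = z.
  move=> ez; elim: k => // k IHk.
  by rewrite hS h'S -comm_h IHk qq'K.
exists W; split.
- rewrite /lnorm big_flatten big_map.
  under eq_bigr => k _ do rewrite -/(lnorm _) lnorm_scale normc_natV.
  rewrite big_const_seq count_predT size_iota iter_addr_0 -[(_ * _) *+ N]mulr_natl mulrA.
  by rewrite divff ?mul1r // gt_eqF.
(* First legs receive only powers of [q], the inverses going to second legs, so closure of [P] under
   multiplication by [Q] is enough. *)
- move=> w /flatten_mapP[k _ /mapP[w0 w0W ->]] /=.
  have [ew0 Pw0] := W0_supp _ w0W; split; first by rewrite comm_h' ew0.
  by elim: k => // k IHk; apply: PQ; rewrite ?inE ?eqxx.
- move=> k; rewrite levW.
  have -> : \sum_(0 <= j < N) lev W0 (fun x y => k (h j x ** h' j y))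
      = \sum_(0 <= j < N) k e.
    apply: eq_bigr => j _; rewrite -(W0_prod k); apply: eq_lev => w wW.
    have [ew _] := W0_supp _ wW; congr k.
    by rewrite oC comm_h [_ ** w.2.1]oC comm_h' hh'K // oCA ew.
  by rewrite big_const_nat subn0 iter_addr_0 -[k e *+ N]scaler_nat scalerA mulVf ?scale1r.
move=> q0; rewrite inE => q0Q g B gB.
have B_ge0 : 0 <= B by rewrite (le_trans (nrm_ge0 (g None None))).
rewrite levW nrmZ normc_natV mulrC ler_pM2r ?invr_gt0 //.
(* An earlier element [q0] commutes with [h k] and [h' k], so the estimate for [W0] survives in each
   term of the average. *)
have [q0_in|q0_out] := boolP (q0 \in Q).
  rewrite (le_trans (nrm_sum _ _ _)) //.
  have -> : 2 * B = \sum_(0 <= k < N) (2 * B / N%:R).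
    rewrite big_const_nat subn0 iter_addr_0 -[(_ / _) *+ N]mulr_natl.
    by rewrite mulrCA divff ?mulr1 // gt_eqF.
  apply: ler_sum => k _.
  have := W0_inv _ q0_in (fun x y => g (h k x) (h' k y)) B (fun x y => gB _ _).
  congr (nrm _ <= _); apply: eq_lev => w wW.
  by rewrite !comm_h !comm_h'.
move: q0Q; rewrite (negPf q0_out) orbF => /eqP ->.
(* For [q0 = q], moving [q] across the tensor shifts k by one and the sum telescopes to [G N - G 0].
   Each end is at most [B] because [lnorm W0 <= 1]. *)
pose G k := lev W0 (fun x y => g (h k x) (h' k (Some q ** y))).
rewrite (eq_bigr (fun k => G k.+1 - G k)) => [|k _].
  rewrite telescope_sumr // (le_trans (nrmB _ _)) // mulr_natl mulr2n lerD //.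
    by rewrite (le_trans (nrm_lev (M := B) _)) // ler_piMl.
  by rewrite (le_trans (nrm_lev (M := B) _)) // ler_piMl.
rewrite levB; congr (_ - _); apply: eq_lev => w wW; last by rewrite comm_h'.
have [ew _] := W0_supp _ wW.
by rewrite hS h'S comm_h' [_ ** (_ ** w.2.2)]oCA qq'K.
Qed.
(* [covered q e l] makes [q * E] either zero or an element of the group with
   unit [e * i * ..], for each of the orthogonal idempotents [E] obtained by
   multiplying [e] by [i] or [1 - i] for every [i] in [l]. *)
Fixpoint covered (q : S) (e : M) (l : seq S) : Prop :=
  if l is i :: l' then
    covered q (e ** Some i) l' /\ (mul q i = q \/ covered q e l')
  else Some (idem q) ** e = e.

(* The diagonal [D(e, l)] is built from
   [D(e, i :: l) = D(e * i, l) + ((1 - i) (x) (1 - i)) D(e, l)]. *)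
Lemma approximate_diagonal (l : seq S) (e : M) (Q : seq S) (N : nat)
    (P : M -> Prop) :
  e ** e = e -> {in l, forall i, mul i i = i} ->
  {in Q, forall q, covered q e l} -> (0 < N)%N ->
  P e -> {in Q ++ l, forall q, forall x, P x -> P (Some q ** x)} ->
  exists W : seq (R[i] * (M * M)),
  [/\ lnorm W <= 5 ^+ size l,
      {in W, forall w, P w.2.1},
      forall k : M -> X, lev W (fun x y => k (x ** y)) = k e &
      {in Q, forall q, forall (g : M -> M -> X) B,
        (forall x y, nrm (g x y) <= B) ->
        nrm (lev W (fun x y => g (Some q ** x) y - g x (Some q ** y)))
          <= 5 ^+ size l * (2 * B / N%:R)}].
Proof.
move=> + + + N_gt0.
elim: l e Q => [|i l IHl] e Q ee l_idem Q_cov Pe P_mul.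
  have [] := @folner_diagonal e Q N P ee Q_cov N_gt0 Pe.
    by move=> q qQ; apply: P_mul; rewrite mem_cat qQ.
  move=> W [W_norm W_supp W_prod W_inv]; exists W; split => //.
    by move=> w /W_supp[].
  by move=> q qQ g B gB; rewrite mul1r W_inv.
have ii : mul i i = i by apply: l_idem; rewrite inE eqxx.
have oii : Some i ** Some i = Some i by rewrite omulE ii.
have P_i x : P x -> P (Some i ** x).
  by apply: P_mul; rewrite mem_cat inE eqxx orbT.
have l_idem' : {in l, forall i, mul i i = i}.
  by move=> j jl; apply: l_idem; rewrite inE jl orbT.
(* An element of [Q] outside [Q2] satisfies [mul q i = q], so 1 - i annihilates it; only [Q2] needs
   invariance on the complementary branch. *)
pose Q2 := [seq q <- Q | `[< covered q e l >]].
have [||||| W1 [W1_norm W1_supp W1_prod W1_inv]] := IHl (e ** Some i) Q => //.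
- by rewrite oA -[e ** _ ** e]oA [Some i ** e]oC oA ee -oA oii.
- by move=> q /Q_cov[].
- by rewrite oC; apply: P_i.
- move=> q; rewrite mem_cat => qQl; apply: P_mul.
  by rewrite mem_cat inE; case/orP: qQl => ->; rewrite ?orbT.
have [||||| W2 [W2_norm W2_supp W2_prod W2_inv]] := IHl e Q2 => //.
- by move=> q; rewrite mem_filter => /andP[/asboolP].
- move=> q; rewrite mem_cat mem_filter => qQl; apply: P_mul.
  by rewrite mem_cat inE; case/orP: qQl => [/andP[_ ->//]|->]; rewrite ?orbT.
pose I := omul mul (Some i).
(* The last four blocks expand (1 - i) (x) (1 - i) applied to [W2]. Five pieces in all explain the
   base 5 of the norm bound. *)
pose W := W1 ++ W2 ++ lscale (-1) I id W2 ++ lscale (-1) id I W2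
             ++ lscale 1 I I W2.
have levW g : lev W g = lev W1 g
    + lev W2 (fun x y => g x y - g (I x) y - g x (I y) + g (I x) (I y)).
  by rewrite !lev_cat !lev_scale levD !levB !scaleN1r scale1r !addrA.
have II x : I (I x) = I x by rewrite /I oA oii.
exists W; split.
- rewrite !lnorm_cat !lnorm_scale normcN1.
  rewrite ComplexField.Normc.normc1 exprS /=; lra.
- move=> w; rewrite !mem_cat => /or4P[|||/orP[]].
  + exact: W1_supp.
  + exact: W2_supp.
  + by move=> /mapP[v /W2_supp Pv ->]; apply: P_i.
  + by move=> /mapP[v /W2_supp Pv ->].
  + by move=> /mapP[v /W2_supp Pv ->]; apply: P_i.
(* As (1 - i)^2 = 1 - i, the four blocks contribute [k e - k (e ** Some i)], which complements the
   value on [W1]. *)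
- move=> k; rewrite levW W1_prod.
  have -> : lev W2 (fun x y => k (x ** y) - k (I x ** y) - k (x ** I y)
                        + k (I x ** I y)) = k e - k (e ** Some i).
    rewrite [e ** _]oC -[k (_ ** e)](W2_prod (fun x => k (I x))).
    rewrite -(W2_prod k) -levB; apply: eq_lev => w _.
    rewrite /I -oA [_ ** (Some i ** _)]oCA -oA [_ ** (Some i ** _)]oCA.
    by rewrite !oA oii subrK.
  by rewrite addrC subrK.
move=> q qQ g B gB.
have B_ge0 : 0 <= B by rewrite (le_trans (nrm_ge0 (g None None))).
have BN_ge0 : 0 <= 2 * B / N%:R by rewrite divr_ge0 // mulr_ge0.
have pow_ge0 : 0 <= 5 ^+ size l :> R by rewrite exprn_ge0.
rewrite levW (le_trans (nrmD _ _)) //.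
have W1g := W1_inv _ qQ g B gB.
have [_ /=[qi|qcov]] := Q_cov _ qQ.
  (* Here q (1 - i) = 0, so the contribution of [W2] cancels identically. *)
  have qI x : Some q ** I x = Some q ** x by rewrite /I oA omulE qi.
  rewrite (eq_lev (W := W2) (g' := fun _ _ => 0)) ?lev0 ?nrm0; last first.
    move=> w _; rewrite !qI.
    set a := g (_ ** _) _; set b := g _ (_ ** _).
    by rewrite !opprB [a - b + _]addrC !subrKA subrr.
  by rewrite addr0 (le_trans W1g) // exprS ler_wpM2r // ler_peMl // ler1n.
have qQ2 : q \in Q2 by rewrite mem_filter qQ andbT; apply/asboolP.
(* The factor (1 - i) (x) (1 - i) is absorbed into the test function at the price of a bound
   [4 * B]; together with [W1] this makes 1 + 4 = 5. *)
pose g' x y := g x y - g (I x) y - g x (I y) + g (I x) (I y).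
have g'B x y : nrm (g' x y) <= 4 * B.
  rewrite (le_trans (nrmD _ _)) // (_ : 4 * B = B + B + B + B); last lra.
  rewrite lerD // (le_trans (nrmB _ _)) // lerD // (le_trans (nrmB _ _)) //.
  by rewrite lerD.
have := W2_inv _ qQ2 g' _ g'B.
rewrite [lev W2 _ in X in X -> _](eq_lev (g' := fun x y => g (Some q ** x) y - g x (Some q ** y) -
   (g (Some q ** I x) y - g (I x) (Some q ** y)) -
   (g (Some q ** x) (I y) - g x (Some q ** I y)) +
   (g (Some q ** I x) (I y) - g (I x) (Some q ** I y)))).
  move=> W2g; rewrite (le_trans (lerD W1g W2g)) // exprS.
  rewrite (_ : 2 * (4 * B) / N%:R = 4 * (2 * B / N%:R)); last by ring.
  by rewrite le_eqVlt; apply/orP; left; apply/eqP; ring.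
move=> w _; rewrite /g' /I ![Some q ** (Some i ** _)]oCA.
rewrite !opprD !opprK addrACA; congr (_ + _).
by rewrite addrACA; congr (_ + _); rewrite addrACA.
Qed.

End ApproximateDiagonal.

(** * Approximate contracting homotopies *)

Section ApproximateHomotopy.
Variables (S : choiceType) (mul : S -> S -> S) (idem inv : S -> S).
Hypothesis mulA : associative mul.
Hypothesis mulC : commutative mul.
Hypothesis mul_idem : forall x, mul (idem x) x = x.
Hypothesis idemM : forall x y, idem (mul x y) = mul (idem x) (idem y).
Hypothesis idemK : forall x, idem (idem x) = idem x.
Hypothesis mul_inv : forall x, mul x (inv x) = idem x.

Local Notation M := (option S).
Local Notation "x ** y" := (omul mul x y) (at level 40, left associativity).

Let oA : associative (omul mul) := omulA mulA.
Let oC : commutative (omul mul) := omulC mulC.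

Inductive generated (l : seq S) : S -> Prop :=
  | generated_mem s : s \in l -> generated l s
  | generated_mul s t : generated l s -> generated l t -> generated l (mul s t).

(** Only the idempotent of [s] is constrained, so this is the whole subsemigroup over the finite
    semilattice generated by the idempotents of [b]. *)
Definition idspan (b : seq S) (s : S) := generated (map idem b) (idem s).

Lemma idspanM b s t : idspan b s -> idspan b t -> idspan b (mul s t).
Proof. by rewrite /idspan idemM; apply: generated_mul. Qed.

Lemma idspan_mem b s : s \in b -> idspan b s.
Proof. by move=> sb; apply/generated_mem/map_f. Qed.

Lemma idspan_idem b s : s \in map idem b -> idspan b s.
Proof.
by move=> sb; apply: generated_mem; move: (sb) => /mapP[t _ st]; rewrite st idemK -st.
Qed.

Lemma idspan_trans b b' s : {in b', forall x, idspan b x} -> idspan b' s -> idspan b s.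
Proof.
rewrite /idspan => b'b; elim=> [t /mapP[u ub' ->]|t u _ ? _ ?].
  exact: b'b.
exact: generated_mul.
Qed.

Lemma covered_mul e l q q' :
  covered mul idem q e l -> covered mul idem q' e l -> covered mul idem (mul q q') e l.
Proof.
elim: l e => [|i l IHl] e /=; first by rewrite idemM -omulE -oA => qe ->.
move=> [c1 n1] [c2 n2]; split; first exact: IHl.
case: n1 => [qi|n1]; first by left; rewrite -mulA [mul q' i]mulC mulA qi.
case: n2 => [qi|n2]; first by left; rewrite -mulA qi.
by right; apply: IHl.
Qed.

Lemma covered_idem e l q : covered mul idem (idem q) e l -> covered mul idem q e l.
Proof.
elim: l e => [|i l IHl] e /=; first by rewrite idemK.
move=> [c1 n1]; split; first exact: IHl.
case: n1 => [qi|n1]; last by right; apply: IHl.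
by left; rewrite -[in LHS](mul_idem q) [mul (idem q) q]mulC -mulA qi mulC mul_idem.
Qed.

(** When the recursion meets [j], it becomes part of the unit on one branch, and [mul j j = j]
    disposes of the other. The second alternative records that [j] has already been absorbed into
    [e]. *)
Lemma covered_mem e l j : mul j j = j ->
  j \in l \/ Some (idem j) ** e = e -> covered mul idem j e l.
Proof.
move=> jj; elim: l e => [|i l IHl] e; first by case.
case=> [|je] /=; first rewrite inE => /orP[/eqP <-|jl].
- split; last by left.
  by apply: IHl; right; rewrite [e ** _]oC oA omulE mul_idem.
- by split; [|right]; apply: IHl; left.
- by split; [|right]; apply: IHl; right => //; rewrite oA je.
Qed.

(** Generators are covered by [covered_mem], their products by [covered_mul], and [covered_idem]
    passes from [idem q] to [q]. *)
Lemma idspan_covered e b q : idspan b q -> covered mul idem q e (map idem b).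
Proof.
move=> bq; apply: covered_idem; elim: bq => [s sb|s t _ + _]; last exact: covered_mul.
apply: covered_mem; last by left.
by case/mapP: sb => t _ ->; rewrite -{1}[idem t]idemK mul_idem.
Qed.

Variables (R : realType) (X : normedModType R[i]) (act : S -> X -> X) (c : R).
Hypothesis act_lin : forall s (l : R[i]) x y,
  act s (l *: x + y) = l *: act s x + act s y.
Hypothesis actM : forall s t x, act (mul s t) x = act s (act t x).
Hypothesis c_ge1 : 1 <= c.
Hypothesis act_bound : forall s x, nrm (act s x) <= c * nrm x.

Implicit Types f : seq S -> X.
Local Notation cob := (cob mul act).
Local Notation rcob := (rcob mul act).

Let c_ge0 : 0 <= c. Proof. by rewrite (le_trans ler01). Qed.

Definition oact (x : M) (v : X) := if x is Some s then act s v else v.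
(* Cochains vanish when an argument is the adjoined unit. *)
Definition ocons f (x : M) m : X := if x is Some s then f (s :: m) else 0.

Let oactM x y v : oact (x ** y) v = oact x (oact y v).
Proof. by case: x y => [s|] [t|] //=; rewrite actM. Qed.

Let oact_bound x v : nrm (oact x v) <= c * nrm v.
Proof. by case: x => [s|] //=; rewrite ler_peMl // nrm_ge0. Qed.

Let oactB x u v : oact x (u - v) = oact x u - oact x v.
Proof. by case: x => [s|] //=; apply: actB. Qed.

Let oactD x u v : oact x (u + v) = oact x u + oact x v.
Proof. by case: x => [s|] //=; apply: actD. Qed.

Let rcob_oact y f a : rcob (fun m => oact y (f m)) a = oact y (rcob f a).
Proof. by case: y => [s|] //=; apply: rcob_act. Qed.

Lemma rcob_lev (W : seq (R[i] * (M * M))) (G : M -> M -> seq S -> X) a :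
  rcob (fun m => lev W (fun x y => G x y m)) a = lev W (fun x y => rcob (G x y) a).
Proof.
elim: W => [|w W IHW].
  rewrite /lev big_nil -[RHS](rcob0 mul act_lin a).
  by apply: eq_rcob => m _; rewrite big_nil.
move: IHW; rewrite /lev big_cons => <-; rewrite -rcob_lin //.
by apply: eq_rcob => m _; rewrite big_cons.
Qed.

Lemma act_lev (W : seq (R[i] * (M * M))) s (G : M -> M -> X) :
  act s (lev W G) = lev W (fun x y => act s (G x y)).
Proof.
elim: W => [|w W IHW]; first by rewrite /lev !big_nil (act0 act_lin).
by rewrite /lev !big_cons act_lin IHW.
Qed.

(** The operator K for the tensor [W]: first legs become a new first argument, second legs act on
    the value. *)
Definition contraction (W : seq (R[i] * (M * M))) f m : X :=
  lev W (fun x y => oact y (ocons f x m)).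

(** At [x = None] the first two terms on the right cancel, so extending cochains by zero to the unit
    is compatible with this expansion. *)
Lemma ocons_cob f x a l :
  ocons (cob f) x (a :: l) =
    oact x (f (a :: l)) - ocons f (Some a ** x) l + rcob (ocons f x) (a :: l).
Proof.
case: x => [s|].
  rewrite /= -/(rcob f [:: s, a & l]) rcob_cons2 opprB mulC.
  by rewrite addrA addrAC.
rewrite subrr add0r -[LHS](rcob0 mul act_lin (a :: l)).
by apply: eq_rcob.
Qed.

(** The faces in [rcob] commute with K and cancel between K d and d K; the product condition
    recovers [f]. What remains is the defect in a D = D a. *)
Lemma contraction_homotopy W f a l :
  (forall k : M -> X, lev W (fun x y => k (x ** y)) = k None) ->
  contraction W (cob f) (a :: l) + cob (contraction W f) (a :: l) - f (a :: l) =
    - lev W (fun x y => oact y (ocons f (Some a ** x) l)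
                     - oact (Some a ** y) (ocons f x l)).
Proof.
move=> W_prod.
have -> : cob (contraction W f) (a :: l) =
    lev W (fun x y => oact (Some a ** y) (ocons f x l)
                      - oact y (rcob (ocons f x) (a :: l))).
  rewrite levB; congr (_ - _).
    by rewrite act_lev; apply: eq_lev => w _; rewrite oactM.
  rewrite rcob_lev; apply: eq_lev => w _; exact: rcob_oact.
rewrite -[X in _ - X = _](W_prod (fun x => oact x (f (a :: l)))).
rewrite -levD -levB levB -opprB -levB; congr (- _); apply: eq_lev => w _.
rewrite ocons_cob oactD oactB -!oactM [w.2.2 ** w.2.1]oC.
rewrite [_ - oact _ (rcob _ _)]addrC [X in _ - X]addrA addrK.
by rewrite opprD opprB addrA; congr (_ - _); rewrite addrC subrK.
Qed.

Lemma contraction_bound W f B M0 :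
  lnorm W <= B -> 0 <= M0 -> forall m,
  (forall w, w \in W -> forall s, w.2.1 = Some s -> nrm (f (s :: m)) <= M0) ->
  nrm (contraction W f m) <= B * (c * M0).
Proof.
move=> WB M0_ge0 m fM.
have cM_ge0 : 0 <= c * M0 by rewrite mulr_ge0.
apply: le_trans (ler_wpM2r cM_ge0 WB); apply: nrm_lev => w wW.
rewrite (le_trans (oact_bound _ _)) // ler_wpM2l //.
case Ew : w.2.1 => [s|] /=; first exact: fM Ew.
by rewrite nrm0.
Qed.

(** The diagonal starts from the unit [None] and the idempotents of [b]. Its norm thus depends only
    on the length of [b], however large the list [Q] is. *)
Lemma contraction_exists (b : seq S) (Q : seq S) (N : nat) :
  (0 < N)%N -> {in Q, forall q, idspan b q} ->
  exists W : seq (R[i] * (M * M)),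
  [/\ lnorm W <= 5 ^+ size b,
      forall w, w \in W -> forall s, w.2.1 = Some s -> idspan b s &
      forall f M0 a l, a \in Q ->
        (forall m, size m = (size l).+1 -> nrm (f m) <= M0) ->
        nrm (contraction W (cob f) (a :: l) + cob (contraction W f) (a :: l)
               - f (a :: l)) <= 5 ^+ size b * (2 * (c * M0) / N%:R)].
Proof.
(* [P] may hold at the unit because [ocons] vanishes there: such a first leg evaluates the cochain
   nowhere. *)
move=> N_gt0 Qb; pose P (x : M) := if x is Some s then idspan b s else True.
have [||||||W [W_norm W_supp W_prod W_inv]] :=
  @approximate_diagonal S mul idem inv mulA mulC mul_inv
    R X (map idem b) None Q N P => //.
- by move=> i /mapP[t _ ->]; rewrite -{1}[idem t]idemK mul_idem.
- by move=> q /Qb; apply: idspan_covered.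
- move=> q; rewrite mem_cat => qQ.
  have Pq : idspan b q by case/orP: qQ => [/Qb//|]; apply: idspan_idem.
  by move=> [s|] //= Ps; apply: idspanM.
exists W; rewrite -(size_map idem b); split=> //.
- by move=> w /W_supp + s ws; rewrite /P ws.
move=> f M0 a l aQ fM; rewrite contraction_homotopy // nrmN.

apply: (W_inv a aQ (fun x y => oact y (ocons f x l)) (c * M0)) => x y.
rewrite (le_trans (oact_bound _ _)) // ler_wpM2l //.
case: x => [s|] /=; first by rewrite fM.
by rewrite nrm0 (le_trans (nrm_ge0 (f (a :: l)))) ?fM.
Qed.
(** [s] goes from degree n + 1 to degree n. [ah_supp] says that [s f b] reads [f] at finitely many
    tuples over the idempotents of [b], chosen independently of [f]. [ah_cob] is s d + d s = id
    tested on a coboundary. In use, [B] and [C] are fixed before [N]. *)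
Record approx_homotopy n (B C N : R) (s : (seq S -> X) -> seq S -> X) : Prop := {
  ah_sub : forall f g b, s (fun m => f m - g m) b = s f b - s g b;
  ah_supp : forall b, size b = n -> exists Q : seq (seq S),
    {in Q, forall m, size m = n.+1 /\ {in m, forall x, idspan b x}} /\
    forall f M0, 0 <= M0 -> {in Q, forall m, nrm (f m) <= M0} -> nrm (s f b) <= C * M0;
  ah_cob : forall f M0 b, size b = n.+1 ->
    (forall m, size m = n -> nrm (f m) <= M0) ->
    nrm (cob f b - cob (s (cob f)) b) <= B * M0 / N }.

(* The inductive step of an acyclic models argument: the new homotopy at [b]
   is the contraction attached to the finite set of idempotents of the entries
   of [b], applied to the almost cycle [b - s (d b)]. *)
Lemma approx_homotopy_step n (B C : R) : 0 <= B -> 0 <= C ->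
  exists B1 B' C' : R, [/\ 0 <= B1, 0 <= B', 0 <= C' &
  forall (N : nat) s, (0 < N)%N -> approx_homotopy n B C N%:R s ->
  exists s', approx_homotopy n.+1 B' C' N%:R s' /\
    forall f M0 b, size b = n.+1 -> (forall m, size m = n.+1 -> nrm (f m) <= M0) ->
    nrm (s' (cob f) b + cob (s f) b - f b) <= B1 * M0 / N%:R].
Proof.
move=> B_ge0 C_ge0.
(* Bounds id - d s at a tuple of length n + 1: the tuple itself, plus n + 2 faces costing [c * C]
   each. *)
pose CZ := 1 + n.+2%:R * (c * C).
have CZ_ge0 : 0 <= CZ by rewrite addr_ge0 ?mulr_ge0.
pose D : R := 5 ^+ n.+1.
have D_ge0 : 0 <= D by rewrite exprn_ge0.
(* The part [2 * CZ] is the defect of the contraction seen through id - d s; [B] is the defect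
   [ah_cob] for a contracted cochain of norm at most [D * (c * M0)]. *)
pose B1 := (B + 2 * CZ) * (D * c).
have B1_ge0 : 0 <= B1.
  by apply: mulr_ge0; [apply: addr_ge0 => // |]; apply: mulr_ge0.
(* A tuple of length n + 2 has n + 3 faces. The last constant multiplies the bound of the
   contraction by that of id - d s. *)
exists B1, (n.+3%:R * (c * B1)), (CZ * (D * c)).
have B'_ge0 : 0 <= n.+3%:R * (c * B1).
  by apply: mulr_ge0 => //; apply: mulr_ge0.
have C'_ge0 : 0 <= CZ * (D * c).
  by apply: mulr_ge0 => //; apply: mulr_ge0.
split=> //.
move=> N s N_gt0 [s_sub s_supp s_cob].
have N_gt0R : 0 < N%:R :> R by rewrite ltr0n.
(* [Z] is id - d s; by [s_cob] it almost kills coboundaries. *)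
pose Z b f := f b - cob (s f) b.
have ZB b f g : Z b (fun m => f m - g m) = Z b f - Z b g.
  rewrite /Z (eq_cob mul act (g := fun m => s f m - s g m)) => [|m _]; last exact: s_sub.
  by rewrite (cobB mul act_lin) !opprD !opprK addrACA.
have Z_supp b : size b = n.+1 -> exists Q : seq (seq S),
    {in Q, forall m, size m = n.+1 /\ {in m, forall x, idspan b x}} /\
    forall f M0, 0 <= M0 -> {in Q, forall m, nrm (f m) <= M0} ->
      nrm (Z b f) <= CZ * M0.
  move=> sz_b.
  have /choice[q q_spec] : forall m, exists Q : seq (seq S), size m = n ->
      {in Q, forall m', size m' = n.+1 /\ {in m', forall x, idspan m x}} /\
      forall f M0, 0 <= M0 -> {in Q, forall m', nrm (f m') <= M0} ->
        nrm (s f m) <= C * M0.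
    move=> m; have [sz_m|sz_m] := eqVneq (size m) n; last first.
      by exists [::] => sz_m'; rewrite sz_m' eqxx in sz_m.
    by have [Q Q_spec] := s_supp m sz_m; exists Q.
  have sz_face m : m \in faces mul b -> size m = n.
    by move=> /size_faces ->; rewrite sz_b.
  (* [Z b] reads the cochain at [b] and wherever [s] does at the faces of [b]; faces stay in the
     span of [b], hence so do those tuples. *)
  exists (b :: flatten (map q (faces mul b))); split.
    move=> m; rewrite inE => /orP[/eqP->|/flatten_mapP[m' m'b mm']].
      by split=> // x; apply: idspan_mem.
    have [/(_ _ mm')[sz_m m_span] _] := q_spec m' (sz_face _ m'b).
    split=> // x xm; apply: (idspan_trans _ (m_span x xm)).
    by apply: mem_faces m'b => [y z|y]; [apply: idspanM | apply: idspan_mem].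
  move=> f M0 M0_ge0 fM; rewrite (le_trans (nrmB _ _)) // mulrDl mul1r lerD //.
    by apply: fM; rewrite inE eqxx.
  rewrite -!mulrA -sz_b; apply: nrm_cob => //; first by rewrite mulr_ge0.
  move=> m mb; have [_] := q_spec m (sz_face _ mb); apply=> // m' m'm.
  by apply: fM; rewrite inE; apply/orP; right; apply/flatten_mapP; exists m.
have /choice[W W_spec] : forall b, exists W : seq (R[i] * (M * M)), size b = n.+1 ->
    [/\ lnorm W <= D,
      exists Q : seq (seq S),
        {in Q, forall m, size m = n.+2 /\ {in m, forall x, idspan b x}} /\
        forall f M0, 0 <= M0 -> {in Q, forall m, nrm (f m) <= M0} ->
          nrm (Z b (contraction W f)) <= CZ * (D * c) * M0 &
      forall f M0, (forall m, size m = n.+1 -> nrm (f m) <= M0) ->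
        nrm (Z b (fun m => contraction W (cob f) m + cob (contraction W f) m - f m))
          <= CZ * (D * (2 * (c * M0) / N%:R))].
  move=> b; have [sz_b|sz_b] := eqVneq (size b) n.+1; last first.
    by exists [::] => sz_b'; rewrite sz_b' eqxx in sz_b.
  have [Q [Q_spec Q_bound]] := Z_supp b sz_b.
  (* Almost invariance is requested just for the entries of the tuples read by [Z b], a finite list
     available before the contraction is chosen. *)
  have [] := @contraction_exists b (flatten Q) N N_gt0.
    by move=> q /flattenP[m /Q_spec[_]]; apply.
  rewrite sz_b -/D => W [W_norm W_supp W_htpy]; exists W => _; split=> //.
    exists [seq s :: m | s <- pmap (fun w => w.2.1) W, m <- Q]; split.
      move=> m' /allpairsP[[x m]] /= [].
      rewrite mem_pmap => /mapP[w wW /esym wx] /Q_spec[sz_m m_span] ->.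
      split; first by rewrite /= sz_m.
      move=> y; rewrite inE => /orP[/eqP->|/m_span//].
      exact: W_supp wW _ wx.
    move=> f M0 M0_ge0 fM; rewrite -!mulrA; apply: Q_bound.
      by rewrite !mulr_ge0.
    move=> m mQ; apply: contraction_bound => // w wW x wx; apply: fM.
    by apply: allpairs_f => //; rewrite mem_pmap; apply/mapP; exists w.
  move=> f M0 fM.
  have M0_ge0 : 0 <= M0.
    by rewrite (le_trans (nrm_ge0 (f b))) // fM.
  apply: Q_bound; first by rewrite !mulr_ge0 // invr_ge0 ltW.
  move=> [|a l] mQ; first by have [] := Q_spec _ mQ.
  have [/= sz_l _] := Q_spec _ mQ.
  apply: W_htpy => [|m sz_m].
    by apply/flattenP; exists (a :: l) => //; rewrite inE eqxx.
  by rewrite fM // sz_m sz_l.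
pose s' f b := Z b (contraction (W b) f).
have contrB b f g m : contraction (W b) (fun m => f m - g m) m =
    contraction (W b) f m - contraction (W b) g m.
  rewrite -levB; apply: eq_lev => w _; rewrite -oactB.
  by case: w.2.1 => [x|] //=; rewrite subr0.
have Z_ext b f g : f =1 g -> Z b f = Z b g.
  by move=> /funext ->.
have main f M0 b : size b = n.+1 -> (forall m, size m = n.+1 -> nrm (f m) <= M0) ->
    nrm (s' (cob f) b + cob (s f) b - f b) <= B1 * M0 / N%:R.
  move=> sz_b fM; have [W_norm _ W_htpy] := W_spec b sz_b.
  have M0_ge0 : 0 <= M0 by rewrite (le_trans (nrm_ge0 (f b))) // fM.
  (* With K the contraction at [b], Z (K d f) - Z f = Z (K d f + d K f - f) - Z (d K f). The first
     term is small by the contraction estimate, the second by [s_cob]. *)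
  have -> : s' (cob f) b + cob (s f) b - f b =
      Z b (fun m => contraction (W b) (cob f) m + cob (contraction (W b) f) m - f m)
      - Z b (cob (contraction (W b) f)).
    rewrite -ZB -[s' _ _ + _ - _]addrA -opprB -/(Z b f) -ZB.
    by apply: Z_ext => m; rewrite addrAC addrK.
  rewrite (le_trans (nrmB _ _)) //.
  have KM m : size m = n -> nrm (contraction (W b) f m) <= D * (c * M0).
    move=> sz_m; apply: contraction_bound => // w _ x _.
    by rewrite fM //= sz_m.
  have := s_cob _ _ b sz_b KM; have := W_htpy f M0 fM.
  rewrite -/(Z b (cob (contraction (W b) f))) => le1 le2.
  rewrite (le_trans (lerD le1 le2)) // le_eqVlt; apply/orP; left; apply/eqP.
  by rewrite /B1; ring.
exists s'; split=> //; clearbody B1; split.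
- by move=> f g b; rewrite /s' -ZB; apply: Z_ext => m; apply: contrB.
- by move=> b sz_b; have [] := W_spec b sz_b.
move=> f M0 b sz_b fM.
(* Since d d = 0, the coboundary of [err] is d s' d f - d f; [main] at the faces of [b] therefore
   yields [ah_cob]. *)
pose err m := s' (cob f) m + cob (s f) m - f m.
have -> : cob f b - cob (s' (cob f)) b = - cob err b.
  have -> : cob err b = cob (fun m => s' (cob f) m - (f m - cob (s f) m)) b.
    by apply: eq_cob => m _; rewrite opprB addrA.
  by rewrite !(cobB mul act_lin) (cob_cob act_lin mulA mulC actM) subr0 [RHS]opprB.
have M0_ge0 : 0 <= M0.
  by rewrite (le_trans (nrm_ge0 (f (behead b)))) // fM // size_behead sz_b.
rewrite nrmN -[_.+3%:R * _ * _ / _]mulrA -[_.+3%:R * _ * _]mulrA -sz_b -!mulrA.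
apply: nrm_cob => //.
  by apply: mulr_ge0 => //; apply: divr_ge0.
move=> m mb; rewrite mulrA; apply: main => //.
by rewrite (size_faces mb) sz_b.
Qed.

Lemma approx_homotopy_exists n : exists B C : R, [/\ 0 <= B, 0 <= C &
  forall N : nat, (0 < N)%N -> exists s, approx_homotopy n B C N%:R s].
Proof.
elim: n => [|n [B [C [B_ge0 C_ge0 IHn]]]].
  (* By symmetry the coboundary of a 0-cochain vanishes, so the zero operator is an exact homotopy
     in degree zero. *)
  exists 0, 0; split=> // N _; exists (fun _ _ => 0); split.
  - by move=> *; rewrite subrr.
  - by move=> b _; exists [::]; split=> // f M0 _ _; rewrite nrm0 mul0r.
  - move=> f M0 [//|x [|//]] _ _.
    by rewrite !cob_seq1 subrr nrm0 !mul0r.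
have [B1 [B' [C' [_ B'_ge0 C'_ge0 step]]]] := approx_homotopy_step n B_ge0 C_ge0.
exists B', C'; split=> // N N_gt0.
have [s s_ah] := IHn N N_gt0.
by have [s' [s'_ah _]] := step N s N_gt0 s_ah; exists s'.
Qed.

(** The approximate primitive is [s T]. Its constant [C] is chosen before the precision [N], so
    accuracy costs nothing in norm. *)
Lemma almost_coboundary n : exists C : R, 0 <= C /\ forall T M0,
  0 <= M0 -> (forall m, size m = n.+1 -> nrm (T m) <= M0) ->
  (forall a, size a = n.+2 -> cob T a = 0) ->
  exists U, (forall m, size m = n -> nrm (U m) <= C * M0) /\
    forall a, size a = n.+1 -> nrm (T a - cob U a) <= M0 / 2.
Proof.
have [B [C [B_ge0 C_ge0 ah]]] := approx_homotopy_exists n.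
have [B1 [B' [C' [B1_ge0 B'_ge0 C'_ge0 step]]]] := approx_homotopy_step n B_ge0 C_ge0.
exists C; split=> // T M0 M0_ge0 TM T_cocycle.
have B2_ge0 : 0 <= 2 * B1 by rewrite mulr_ge0.
(* [N] exceeds [2 * B1], which makes the error [B1 * M0 / N] at most [M0 / 2]. *)
have := archi_boundP B2_ge0; set N := Num.bound _ => N_gt.
have N_gt0 : (0 < N)%N by rewrite -(ltr_nat R) (le_lt_trans B2_ge0).
have [s s_ah] := ah N N_gt0.
have [s' [s'_ah s'_htpy]] := step N s N_gt0 s_ah.
exists (s T); split=> [m sz_m|a sz_a].
  have [Q [Q_size]] := ah_supp s_ah sz_m; apply=> // m' /Q_size[sz_m' _].
  exact: TM.
(* By [ah_supp], [s'] reads [cob T] only at tuples of length n + 2, where it vanishes. *)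
have s'T0 : s' (cob T) a = 0.
  have [Q [Q_size Q_bound]] := ah_supp s'_ah sz_a.
  apply: nrm_le0_eq0; rewrite -[leRHS](mulr0 C') Q_bound // => m /Q_size[sz_m _].
  by rewrite T_cocycle ?nrm0.
have := s'_htpy T M0 a sz_a TM; rewrite s'T0 add0r -nrmN opprB => /le_trans; apply.
rewrite ler_pdivrMr ?ltr0n // -mulrA [B1 * _]mulrC ler_wpM2l //.
by rewrite ler_pdivlMl ?ltW.
Qed.

End ApproximateHomotopy.

(** * Unconditional sums and l^1 *)

Section Sums.
Local Open Scope classical_set_scope.
Variables (R : realType) (I : choiceType).
Implicit Types A B : {fset I}.

Lemma partial_sumE (V : zmodType) (x : I -> V) A :
  partial_sum x A = \sum_(i <- A) x i.
Proof. by rewrite big_seq_fsetE. Qed.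

Lemma fsum_split (V : zmodType) (x : I -> V) A B : (A `<=` B)%fset ->
  \sum_(i <- B) x i = \sum_(i <- A) x i + \sum_(i <- B | i \notin A) x i.
Proof.
move=> /fsubsetP AB; rewrite (bigID (mem A)) /=; congr (_ + _).
rewrite -big_filter; apply: perm_big; apply: uniq_perm.
- by rewrite filter_uniq ?fset_uniq.
- exact: fset_uniq.
- by move=> i; rewrite mem_filter; apply: andb_idr => /AB.
Qed.

Lemma fsum_mono (r : I -> R) A B : (forall i, 0 <= r i) -> (A `<=` B)%fset ->
  \sum_(i <- A) r i <= \sum_(i <- B) r i.
Proof. by move=> r_ge0 /(fsum_split r) ->; rewrite lerDl sumr_ge0. Qed.

Lemma fsum_sub_le (r : I -> R) (s : seq I) B : (forall i, 0 <= r i) ->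
  uniq s -> {subset s <= B} -> \sum_(i <- s) r i <= \sum_(i <- B) r i.
Proof.
move=> r_ge0 s_uniq sB.
rewrite (perm_big [fset i in s]%fset) /=; last first.
  by apply: uniq_perm => // i; rewrite !inE.
by apply: fsum_mono => //; apply/fsubsetP => i; rewrite !inE; apply: sB.
Qed.

#[local] Instance totally_filter : ProperFilter (@totally I).
Proof.
eapply filter_from_proper; last by move=> A _; exists A; rewrite /= fsubset_refl.
apply: filter_from_filter; first by exists fset0.
move=> A B _ _; exists (A `|` B)%fset => // D /=.
by rewrite fsubUset => /andP[].
Qed.

Section Normed.
Variable V : normedModType R[i].
Implicit Types (x y : I -> V) (l k : V).

Definition sums x l := forall e : R, 0 < e ->
  exists A, forall B, (A `<=` B)%fset -> nrm (\sum_(i <- B) x i - l) <= e.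

Lemma sumsP x l : sums x l <-> partial_sum x @ totally --> l.
Proof.
split=> [xl|/cvgrPdist_le xl e e_gt0].
  apply/cvgrPdist_le => e e_gt0.
  have e_real : (complex.Re e)%:C%C = e by rewrite RRe_real // gtr0_real.
  have [|A A_l] := xl (complex.Re e); first by rewrite -ltcR e_real.
  exists A => // B /A_l; rewrite partial_sumE -lecR e_real -nrmE.
  by rewrite distrC.
have [|A _ A_l] := xl e%:C%C; first by rewrite ltcR.
by exists A => B /A_l; rewrite /= partial_sumE distrC nrmE lecR.
Qed.

Definition vsum x : V := lim (partial_sum x @ totally).

Lemma vsumE x l : sums x l -> vsum x = l.
Proof. by move=> /sumsP; apply: cvg_lim; apply: norm_hausdorff. Qed.

Definition abs_bounded x (M : R) := forall A, \sum_(i <- A) nrm (x i) <= M.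

(** Take a finite set whose sum of norms is within [e] of the supremum; anything disjoint from it
    can add at most [e]. *)
Lemma abs_bounded_tail x M e : abs_bounded x M -> 0 < e ->
  exists A, forall s : seq I, uniq s -> {in s, forall i, i \notin A} ->
    \sum_(i <- s) nrm (x i) <= e.
Proof.
move=> xM e_gt0.
pose E := [set \sum_(i <- A) nrm (x i) | A in [set: {fset I}]].
have E_sup : has_sup E.
  split; first by exists (\sum_(i <- fset0) nrm (x i)), fset0.
  by exists M => _ [A _ <-]; apply: xM.
have [_ [A _ <-] A_sup] := sup_adherent e_gt0 E_sup.
exists A => s s_uniq sA.
have AsE : \sum_(i <- (A `|` [fset i in s])%fset) nrm (x i) <= sup E.
  by apply: sup_upper_bound => //; exists (A `|` [fset i in s])%fset.
have : \sum_(i <- A ++ s) nrm (x i) <= sup E.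
  apply: le_trans AsE; apply: fsum_sub_le => [i||i]; first exact: nrm_ge0.
    rewrite cat_uniq fset_uniq s_uniq andbT; apply/hasPn => i /sA.
    by [].
  by rewrite mem_cat !inE.
by rewrite big_cat /=; lra.
Qed.

Lemma sums_bound x l M : abs_bounded x M -> sums x l -> nrm l <= M.
Proof.
move=> xM xl; apply/ler_addgt0Pr => e e_gt0.
have [A /(_ A (fsubset_refl _)) A_l] := xl e e_gt0.
have := nrmB (\sum_(i <- A) x i) (\sum_(i <- A) x i - l).
rewrite subKr => /le_trans; apply; apply: lerD => //.
by rewrite (le_trans (nrm_sum _ _ _)).
Qed.

Lemma sums_lin x y l k (c : R[i]) : sums x l -> sums y k ->
  sums (fun i => c *: x i + y i) (c *: l + k).
Proof.
move=> /sumsP xl /sumsP yk; apply/sumsP.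
rewrite (_ : partial_sum _ = fun A => c *: partial_sum x A + partial_sum y A).
  by apply: cvgD => //; apply: cvgZr.
by apply/funext => A; rewrite !partial_sumE big_split /= scaler_sumr.
Qed.

Lemma sums0 : sums (fun=> 0) 0.
Proof. by move=> e e_gt0; exists fset0 => B _; rewrite big1 // subr0 nrm0 ltW. Qed.

End Normed.

Lemma sums_map (V W : normedModType R[i]) (phi : V -> W) (c : R) (x : I -> V) l :
  (forall (a : R[i]) u v, phi (a *: u + v) = a *: phi u + phi v) ->
  (forall u, nrm (phi u) <= c * nrm u) ->
  sums x l -> sums (fun i => phi (x i)) (phi l).
Proof.
move=> phi_lin phi_bound xl e e_gt0.
have phi0 : phi 0 = 0.
  by rewrite -[RHS](addNr (phi 0)) -scaleN1r -phi_lin scaler0 addr0.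
have phiD u v : phi (u + v) = phi u + phi v.
  by rewrite -[u in LHS]scale1r phi_lin scale1r.
have phiB u v : phi (u - v) = phi u - phi v.
  by rewrite addrC -scaleN1r phi_lin scaleN1r addrC.
have c1_gt0 : 0 < `|c| + 1 by rewrite ltr_wpDl.
have [|A A_l] := xl (e / (`|c| + 1)); first by rewrite divr_gt0.
exists A => B /A_l; rewrite ler_pdivlMr // mulrC => B_l.
rewrite -(big_morph phi phiD phi0) -phiB (le_trans (phi_bound _)) //.
apply: le_trans B_l; rewrite ler_wpM2r ?nrm_ge0 //.
by rewrite (le_trans (ler_norm c)) // lerDl.
Qed.

Lemma sums_complete (V : completeNormedModType R[i]) (x : I -> V) M :
  abs_bounded x M -> sums x (vsum x).
Proof.
move=> xM; apply/sumsP; apply/cauchy_cvgP; apply: cauchy_exP => e e_gt0.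
have e_real : (complex.Re e)%:C%C = e by rewrite RRe_real // gtr0_real.
(* Half the radius turns the weak tail estimate into membership in an open ball. *)
have [|A A_tail] := abs_bounded_tail (e := complex.Re e / 2) xM.
  by rewrite divr_gt0 // -ltcR e_real.
exists (partial_sum x A); exists A => // B /= AB.
rewrite -ball_normE /= !partial_sumE (fsum_split x AB) opprD addNKr normrN nrmE.
rewrite -e_real ltcR (le_lt_trans (nrm_sum _ _ _)) //.
rewrite -big_filter (le_lt_trans (A_tail _ _ _)) ?filter_uniq ?fset_uniq //.
  by move=> i; rewrite mem_filter => /andP[].
by rewrite ltr_pdivrMr // ltr_pMr ?ltr1n // -ltcR e_real.
Qed.

End Sums.

(** * Unconditional sums of complex numbers *)

Section ComplexSums.
Variables (R : realType) (I : choiceType).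

Lemma nrm_complex (z : R[i]^o) : nrm z = normc z.
Proof. by rewrite /nrm normc_def; case: z. Qed.

Lemma real_sums (r : I -> R) M : (forall i, 0 <= r i) ->
  (forall A : {fset I}, \sum_(i <- A) r i <= M) ->
  exists l, @sums R I R[i]^o (fun i => (r i)%:C%C) l.
Proof.
move=> r_ge0 rM.
pose E := [set \sum_(i <- A) r i | A in [set: {fset I}]]%classic.
have E_sup : has_sup E.
  split; first by exists (\sum_(i <- fset0) r i), fset0.
  by exists M => _ [A _ <-]; apply: rM.
exists (sup E)%:C%C => e e_gt0.
have [_ [A _ <-] A_sup] := sup_adherent e_gt0 E_sup.
exists A => B AB; rewrite -rmorph_sum -rmorphB nrm_complex /normc /= expr0n addr0.
have B_sup : \sum_(i <- B) r i <= sup E by apply: sup_upper_bound => //; exists B.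
rewrite sqrtr_sqr distrC ger0_norm ?subr_ge0 //.
by have := fsum_mono r_ge0 AB; lra.
Qed.

(** The identity z = (|z| + Re z) + i (|z| + Im z) - (1 + i) |z| reduces the claim to nonnegative
    real families, whose sums are suprema. *)
Lemma complex_sums (x : I -> R[i]^o) M : abs_bounded x M -> exists l, sums x l.
Proof.
move=> xM.
have n_bound (A : {fset I}) : \sum_(i <- A) normc (x i) <= M.
  by rewrite (le_trans _ (xM A)) //; under eq_bigr do rewrite -nrm_complex.
have Re_le (z : R[i]) : `|complex.Re z| <= normc z.
  by case: z => a b; rewrite /= -sqrtr_sqr ler_sqrt ?lerDl ?addr_ge0 ?sqr_ge0.
have Im_le (z : R[i]) : `|complex.Im z| <= normc z.
  by case: z => a b; rewrite /= -sqrtr_sqr ler_sqrt ?lerDr ?addr_ge0 ?sqr_ge0.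
have shift (p : R[i] -> R) : (forall z, `|p z| <= normc z) ->
    exists l, @sums R I R[i]^o (fun i => (normc (x i) + p (x i))%:C%C) l.
  move=> p_le; apply: (@real_sums _ (M + M)) => [i|A].
    by have := p_le (x i); rewrite ler_norml; lra.
  rewrite big_split lerD //= (le_trans _ (n_bound A)) // ler_sum // => i _.
  by rewrite (le_trans (ler_norm _)).
have [n n_sum] := real_sums (fun i => normc_ge0 (x i)) n_bound.
have [u u_sum] := shift _ Re_le; have [v v_sum] := shift _ Im_le.
exists (- (1 + 'i%C) *: n + ('i%C *: v + u)).
have := sums_lin (- (1 + 'i%C)) n_sum (sums_lin 'i%C v_sum u_sum).
congr (sums _ _); apply/funext => i; rewrite [RHS]complexE /GRing.scale /= !rmorphD /=.
by ring.
Qed.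

Lemma complex_vsum (x : I -> R[i]^o) M : abs_bounded x M -> sums x (vsum x).
Proof. by move=> /complex_sums[l xl]; rewrite (vsumE xl). Qed.

End ComplexSums.

(** * The space l^1, its point masses and its bounded linear maps *)

Section L1.
Variables (R : realType) (S : choiceType).
Implicit Types a b : S -> R[i].

Definition delta (s : S) : S -> R[i] := fun t => (t == s)%:R.

Lemma l1P a : l1 a <-> exists M, forall A : {fset S}, \sum_(i <- A) normc (a i) <= M.
Proof.
by split=> -[M aM]; exists M => A; have := aM A; rewrite partial_sumE.
Qed.

Lemma l1norm_ge a (A : {fset S}) : l1 a -> \sum_(i <- A) normc (a i) <= l1norm a.
Proof.
move=> [M aM]; rewrite -partial_sumE; apply: sup_upper_bound; last by exists A.
split; first by exists (partial_sum (fun s => normc (a s)) A), A.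
by exists M => _ [B _ <-].
Qed.

Lemma l1norm_le a M : (forall A : {fset S}, \sum_(i <- A) normc (a i) <= M) ->
  l1norm a <= M.
Proof.
move=> aM; apply: ge_sup; first by exists (partial_sum (fun s => normc (a s)) fset0), fset0.
by move=> _ [A _ <-]; rewrite partial_sumE.
Qed.

Lemma l1norm_ge0 a : l1 a -> 0 <= l1norm a.
Proof. by move=> /(l1norm_ge fset0); rewrite big_seq_fset0. Qed.

Lemma l1_lin (l : R[i]) a b : l1 a -> l1 b -> l1 (fun s => l * a s + b s).
Proof.
move=> a_l1 b_l1; apply/l1P; exists (normc l * l1norm a + l1norm b) => A.
apply: (@le_trans _ _ (\sum_(i <- A) (normc l * normc (a i) + normc (b i)))).
  apply: ler_sum => i _; rewrite -ComplexField.Normc.normcM.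
  by rewrite -[normc (_ + _)]nrm_complex (le_trans (nrmD _ _)) // !nrm_complex.
rewrite big_split /= -mulr_sumr lerD ?l1norm_ge //.
by rewrite ler_wpM2l ?normc_ge0 ?l1norm_ge.
Qed.

Lemma delta_sum_le s (A : {fset S}) : \sum_(i <- A) normc (delta s i) <= 1.
Proof.
have [sA|sA] := boolP (s \in A).
  rewrite (big_fsetD1 s) //= /delta eqxx ComplexField.Normc.normc1.
  rewrite big_seq big1 ?addr0 // => i; rewrite !inE => /andP[/negPf-> _].
  exact: ComplexField.Normc.normc0.
rewrite big_seq big1 // => i iA; rewrite /delta; case: eqP => [is_s|_].
  by rewrite -is_s iA in sA.
exact: ComplexField.Normc.normc0.
Qed.

Lemma l1_delta s : l1 (delta s).
Proof. by apply/l1P; exists 1; apply: delta_sum_le. Qed.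

Lemma l1norm_delta s : l1norm (delta s) <= 1.
Proof. exact/l1norm_le/delta_sum_le. Qed.

Lemma l1_0 : l1 (fun _ : S => 0 : R[i]).
Proof.
by apply/l1P; exists 0 => A; rewrite big1 // => i _; apply: ComplexField.Normc.normc0.
Qed.

Lemma l1norm0 : l1norm (fun _ : S => 0 : R[i]) = 0.
Proof.
apply/le_anti; rewrite l1norm_ge0 ?andbT; last exact: l1_0.
by apply: l1norm_le => A; rewrite big1 // => i _; apply: ComplexField.Normc.normc0.
Qed.

Variable X : completeNormedModType R[i].
Implicit Types v w : S -> X.

(** The bounded linear extension to l^1 of a bounded function [v] on point masses. *)
Definition xsum a v : X := vsum (fun s => a s *: v s).

Definition bdd v (M : R) := 0 <= M /\ forall s, nrm (v s) <= M.

Lemma xsum_abs a v M : l1 a -> bdd v M ->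
  abs_bounded (fun s => a s *: v s) (l1norm a * M).
Proof.
move=> a_l1 [M_ge0 vM] A; apply: (@le_trans _ _ (\sum_(i <- A) (normc (a i) * M))).
  by apply: ler_sum => i _; rewrite nrmZ ler_wpM2l ?normc_ge0.
by rewrite -mulr_suml ler_wpM2r // l1norm_ge.
Qed.

Lemma xsum_sums a v M : l1 a -> bdd v M -> sums (fun s => a s *: v s) (xsum a v).
Proof. by move=> a_l1 /(xsum_abs a_l1); apply: sums_complete. Qed.

Lemma xsum_bound a v M : l1 a -> bdd v M -> nrm (xsum a v) <= l1norm a * M.
Proof.
by move=> a_l1 vM; apply: sums_bound (xsum_sums a_l1 vM); apply: xsum_abs.
Qed.

Lemma xsum_linl (l : R[i]) a b v M : l1 a -> l1 b -> bdd v M ->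
  xsum (fun s => l * a s + b s) v = l *: xsum a v + xsum b v.
Proof.
move=> a_l1 b_l1 vM; apply: vsumE.
have := sums_lin l (xsum_sums a_l1 vM) (xsum_sums b_l1 vM).
by congr (sums _ _); apply/funext => s; rewrite scalerDl scalerA.
Qed.

Lemma xsum_linr (l : R[i]) a v w M N : l1 a -> bdd v M -> bdd w N ->
  xsum a (fun s => l *: v s + w s) = l *: xsum a v + xsum a w.
Proof.
move=> a_l1 vM wN; apply: vsumE.
have := sums_lin l (xsum_sums a_l1 vM) (xsum_sums a_l1 wN).
congr (sums _ _); apply/funext => s.
by rewrite scalerDr !scalerA mulrC.
Qed.

Lemma xsumB a v w M N : l1 a -> bdd v M -> bdd w N ->
  xsum a (fun s => v s - w s) = xsum a v - xsum a w.
Proof.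
move=> a_l1 vM wN; rewrite addrC -scaleN1r -(xsum_linr _ a_l1 wN vM).
by congr xsum; apply/funext => s; rewrite scaleN1r addrC.
Qed.

Lemma xsum_map (phi : X -> X) (c : R) a v M :
  (forall (l : R[i]) x y, phi (l *: x + y) = l *: phi x + phi y) ->
  (forall x, nrm (phi x) <= c * nrm x) -> l1 a -> bdd v M ->
  phi (xsum a v) = xsum a (fun s => phi (v s)).
Proof.
move=> phi_lin phi_bound a_l1 vM; apply/esym/vsumE.
have := sums_map phi_lin phi_bound (xsum_sums a_l1 vM).
congr (sums _ _); apply/funext => s.
have phi0 : phi 0 = 0.
  by rewrite -[RHS](addNr (phi 0)) -scaleN1r -phi_lin scaler0 addr0.
by rewrite -[a s *: v s]addr0 phi_lin phi0 addr0.
Qed.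

(** Restrictions of [a] to finite sets are combinations of point masses and converge to [a] in norm,
    so boundedness determines [phi a]. *)
Lemma l1_linear_xsum (phi : (S -> R[i]) -> X) (c : R) a :
  (forall (l : R[i]) a b, l1 a -> l1 b ->
     phi (fun s => l * a s + b s) = l *: phi a + phi b) ->
  (forall a, l1 a -> nrm (phi a) <= c * l1norm a) -> l1 a ->
  phi a = xsum a (fun s => phi (delta s)).
Proof.
move=> phi_lin phi_bound a_l1; apply/esym/vsumE.
have phi0 : phi (fun=> 0) = 0.
  by apply: nrm_le0_eq0; rewrite (le_trans (phi_bound _ l1_0)) // l1norm0 mulr0.
pose part (r : seq S) : S -> R[i] := fun t => \sum_(s <- r) a s * delta s t.
have partE r : l1 (part r) /\ phi (part r) = \sum_(s <- r) a s *: phi (delta s).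
  elim: r => [|s r [IHl1 IHphi]].
    have -> : part [::] = fun=> 0 by apply/funext => t; rewrite /part big_nil.
    by rewrite big_nil; split; [exact: l1_0|].
  have -> : part (s :: r) = fun t => a s * delta s t + part r t.
    by apply/funext => t; rewrite /part big_cons.
  rewrite big_cons -IHphi; split; first exact: l1_lin (l1_delta s) IHl1.
  by apply: phi_lin => //; apply: l1_delta.
move=> e e_gt0.
have a_bounded : @abs_bounded R S R[i]^o a (l1norm a).
  by move=> A; under eq_bigr do rewrite nrm_complex; apply: l1norm_ge.
(* The sign of [c] is unknown, hence a manifestly positive divisor. *)
have c1_gt0 : 0 < `|c| + 1 by rewrite ltr_wpDl.
have [|A A_tail] := abs_bounded_tail (e := e / (`|c| + 1)) a_bounded.
  by rewrite divr_gt0.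
exists A => B /fsubsetP AB.
have [part_l1 <-] := partE B.
have -> : phi (part B) - phi a = phi (fun s => (-1) * a s + part B s).
  by rewrite phi_lin // scaleN1r addrC.
have diff_l1 := l1_lin (-1) a_l1 part_l1.
rewrite (le_trans (phi_bound _ diff_l1)) //.
have diff_le : l1norm (fun s => -1 * a s + part B s) <= e / (`|c| + 1).
  apply: l1norm_le => D.
  apply: le_trans (A_tail [seq s <- D | s \notin B] _ _); first last.
  - by move=> i; rewrite mem_filter => /andP[iB _]; apply: contra iB => /AB.
  - by rewrite filter_uniq ?fset_uniq.
  rewrite big_filter [leRHS]big_mkcond /=; apply: ler_sum => s _.
  have -> : part B s = if s \in B then a s else 0.
    rewrite /part; case: ifP => sB; last first.
      rewrite big_seq big1 // => t tB; rewrite /delta; case: eqP => [st|_].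
        by rewrite st tB in sB.
      by rewrite mulr0.
    rewrite (big_fsetD1 s) //= /delta eqxx mulr1.
    rewrite big_seq big1 ?addr0 // => t; rewrite !inE eq_sym => /andP[/negPf-> _].
    by rewrite mulr0.
  case: ifP => sB /=; first by rewrite mulN1r addNr ComplexField.Normc.normc0.
  by rewrite addr0 ComplexField.Normc.normcM normcN1 mul1r nrm_complex.
move: diff_le; rewrite ler_pdivlMr // mulrC; apply: le_trans.
by rewrite ler_wpM2r ?l1norm_ge0 // (le_trans (ler_norm c)) // lerDl.
Qed.

Lemma xsum_delta s v M : bdd v M -> xsum (delta s) v = v s.
Proof.
move=> vM; apply: vsumE => e e_gt0; exists [fset s]%fset => B.
rewrite fsub1set => sB; rewrite (big_fsetD1 s) //= /delta eqxx scale1r.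
rewrite big_seq big1 ?addr0 ?subrr ?nrm0 ?ltW // => t.
by rewrite !inE => /andP[/negPf-> _]; rewrite scale0r.
Qed.

End L1.

(** * Convolution on l^1 *)

Section Convolution.
Variables (R : realType) (S : choiceType) (mul : S -> S -> S).
Implicit Types a b : S -> R[i].

Local Notation conv := (@Defs.conv R S mul).

Let cterm a b u (p : S * S) : R[i]^o :=
  if mul p.1 p.2 == u then a p.1 * b p.2 else 0.

Let ctermE a b u p : cterm a b u p = a p.1 * b p.2 * delta R (mul p.1 p.2) u.
Proof. by rewrite /cterm /delta eq_sym; case: eqP => _; rewrite ?mulr1 ?mulr0. Qed.

Let convE a b u : conv a b u = vsum (cterm a b u).
Proof. by []. Qed.

(** Enlarge [D] to the product of its two projections, where the sum factors. *)
Lemma sum_pair_le a b (D : {fset S * S}) : l1 a -> l1 b ->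
  \sum_(p <- D) normc (a p.1) * normc (b p.2) <= l1norm a * l1norm b.
Proof.
move=> a_l1 b_l1.
pose A := [fset p.1 | p in D]%fset; pose B := [fset p.2 | p in D]%fset.
have AB_uniq : uniq [seq (s, t) | s <- A, t <- B].
  by apply: allpairs_uniq; rewrite ?fset_uniq // => -[? ?] [? ?].
apply: (@le_trans _ _ (\sum_(p <- [fset p in [seq (s, t) | s <- A, t <- B]]%fset)
                          normc (a p.1) * normc (b p.2))).
  apply: fsum_sub_le => [p||[s t] stD].
  - by rewrite mulr_ge0 ?normc_ge0.
  - exact: fset_uniq.
  - rewrite !inE; apply/allpairsP; exists (s, t); split=> //=.
      by apply/imfsetP; exists (s, t).
    by apply/imfsetP; exists (s, t).
rewrite (perm_big [seq (s, t) | s <- A, t <- B]) /=; last first.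
  by apply: uniq_perm => [||p]; rewrite ?fset_uniq // !inE.
rewrite big_allpairs_dep /=.
under eq_bigr do rewrite -mulr_sumr.
rewrite -mulr_suml ler_pM ?l1norm_ge //; apply: sumr_ge0 => *; exact: normc_ge0.
Qed.

Lemma conv_sums a b u : l1 a -> l1 b -> sums (cterm a b u) (conv a b u).
Proof.
move=> a_l1 b_l1; apply: (@complex_vsum _ _ _ (l1norm a * l1norm b)) => D.
apply: le_trans (sum_pair_le D a_l1 b_l1); apply: ler_sum => p _.
rewrite nrm_complex /cterm; case: ifP => _.
  by rewrite ComplexField.Normc.normcM.
by rewrite ComplexField.Normc.normc0 mulr_ge0 ?normc_ge0.
Qed.

(** Finitely many sums can be approximated over one common finite index set. *)
Lemma sums_family_bound (I : choiceType) (J : eqType) (V : normedModType R[i])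
    (s : seq J) (x : J -> I -> V) (l : J -> V) L :
  (forall j, sums (x j) (l j)) ->
  (forall B : {fset I}, \sum_(j <- s) nrm (\sum_(i <- B) x j i) <= L) ->
  \sum_(j <- s) nrm (l j) <= L.
Proof.
move=> xl xL; apply/ler_addgt0Pr => e.
have : forall e, 0 < e -> exists A : {fset I}, forall B, (A `<=` B)%fset ->
    \sum_(j <- s) nrm (l j) <= \sum_(j <- s) nrm (\sum_(i <- B) x j i) + e.
  elim: s {xL} => [|j s IHs] d d_gt0.
    by exists fset0 => B _; rewrite !big_nil add0r ltW.
  have d2_gt0 : 0 < d / 2 by rewrite divr_gt0.
  have [A A_s] := IHs _ d2_gt0; have [D D_j] := xl j _ d2_gt0.
  exists (A `|` D)%fset => B; rewrite fsubUset => /andP[/A_s le1 /D_j le2].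
  rewrite !big_cons.
  have := nrmB (\sum_(i <- B) x j i) (\sum_(i <- B) x j i - l j).
  rewrite subKr; lra.
move=> approx /approx[A /(_ A (fsubset_refl _))] /le_trans; apply.
by rewrite lerD2r.
Qed.

(** Each pair feeds a single point [u], so after exchanging the sums its mass is counted at most
    once. *)
Lemma conv_sum_le a b (A : {fset S}) : l1 a -> l1 b ->
  \sum_(u <- A) normc (conv a b u) <= l1norm a * l1norm b.
Proof.
move=> a_l1 b_l1; under eq_bigr do rewrite -nrm_complex.
apply: (sums_family_bound (fun u => conv_sums u a_l1 b_l1)) => D.
apply: le_trans (sum_pair_le D a_l1 b_l1).
apply: (@le_trans _ _ (\sum_(u <- A) \sum_(p <- D) normc (cterm a b u p))).
  by apply: ler_sum => u _; rewrite (le_trans (nrm_sum _ _ _)).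
rewrite exchange_big /=; apply: ler_sum => p _.
under eq_bigr do rewrite ctermE ComplexField.Normc.normcM.
rewrite -mulr_sumr -ComplexField.Normc.normcM.
by rewrite ler_piMr ?normc_ge0 ?delta_sum_le.
Qed.

Lemma l1_conv a b : l1 a -> l1 b -> l1 (conv a b).
Proof.
by move=> a_l1 b_l1; apply/l1P; exists (l1norm a * l1norm b) => A; apply: conv_sum_le.
Qed.

Lemma l1norm_conv a b : l1 a -> l1 b -> l1norm (conv a b) <= l1norm a * l1norm b.
Proof. by move=> a_l1 b_l1; apply: l1norm_le => A; apply: conv_sum_le. Qed.

Lemma conv_linl (l : R[i]) a a' b : l1 a -> l1 a' -> l1 b ->
  conv (fun s => l * a s + a' s) b = fun u => l * conv a b u + conv a' b u.
Proof.
move=> a_l1 a'_l1 b_l1; apply/funext => u; rewrite convE; apply: (@vsumE R _ R[i]^o).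
have := sums_lin l (conv_sums u a_l1 b_l1) (conv_sums u a'_l1 b_l1).
congr (sums _ _); apply/funext => p; rewrite !ctermE /GRing.scale /=.
by ring.
Qed.

Lemma conv_linr (l : R[i]) a b b' : l1 a -> l1 b -> l1 b' ->
  conv a (fun s => l * b s + b' s) = fun u => l * conv a b u + conv a b' u.
Proof.
move=> a_l1 b_l1 b'_l1; apply/funext => u; rewrite convE; apply: (@vsumE R _ R[i]^o).
have := sums_lin l (conv_sums u a_l1 b_l1) (conv_sums u a_l1 b'_l1).
congr (sums _ _); apply/funext => p; rewrite !ctermE /GRing.scale /=.
by ring.
Qed.

Lemma conv_delta s t : conv (delta R s) (delta R t) = delta R (mul s t).
Proof.
apply/funext => u; rewrite convE; apply: (@vsumE R _ R[i]^o) => e e_gt0; exists [fset (s, t)]%fset => B.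
rewrite fsub1set => stB; rewrite (big_fsetD1 (s, t)) //=.
rewrite ctermE /= /delta !eqxx !mul1r.
rewrite big_seq big1 ?addr0 ?subrr ?nrm0 ?ltW // => -[p q].
rewrite !inE xpair_eqE negb_and => /andP[pq _].
rewrite ctermE /= /delta.
by case/orP: pq => /negPf->; rewrite ?mulr0 !mul0r.
Qed.

Variable X : completeNormedModType R[i].

(** The left side is bounded and linear in each of [a] and [b]; expanding both over point masses
    leaves [conv_delta]. *)
Lemma xsum_conv a b (v : S -> X) M : l1 a -> l1 b -> bdd v M ->
  xsum (conv a b) v = xsum a (fun s => xsum b (fun t => v (mul s t))).
Proof.
move=> a_l1 b_l1 vM; have [M_ge0 _] := vM.
have bound a' b' : l1 a' -> l1 b' ->
    nrm (xsum (conv a' b') v) <= M * (l1norm a' * l1norm b').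
  move=> a'_l1 b'_l1; have ab_l1 := l1_conv a'_l1 b'_l1.
  rewrite (le_trans (xsum_bound ab_l1 vM)) // mulrC ler_wpM2l //.
  exact: l1norm_conv.
rewrite (@l1_linear_xsum _ _ _ (fun a => xsum (conv a b) v) (M * l1norm b)) //.
- congr xsum; apply/funext => s.
  rewrite (@l1_linear_xsum _ _ _ (fun b => xsum (conv (delta R s) b) v) (M * 1)) //.
  + by congr xsum; apply/funext => t; rewrite conv_delta (xsum_delta _ vM).
  + move=> l c d c_l1 d_l1; have s_l1 := l1_delta R s.
    by rewrite conv_linr // (xsum_linl _ _ _ vM) //; apply: l1_conv.
  + move=> c c_l1; rewrite (le_trans (bound _ _ (l1_delta R s) c_l1)) // -mulrA.
    by rewrite ler_wpM2l // ler_wpM2r ?l1norm_ge0 // l1norm_delta.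
- move=> l c d c_l1 d_l1.
  by rewrite conv_linl // (xsum_linl _ _ _ vM) //; apply: l1_conv.
- by move=> c c_l1; rewrite -mulrA [l1norm b * _]mulrC bound.
Qed.

End Convolution.

(** * Exact bounded cobounding *)

Section Iteration.
Variables (S : choiceType) (mul : S -> S -> S) (idem inv : S -> S).
Hypothesis mulA : associative mul.
Hypothesis mulC : commutative mul.
Hypothesis mul_idem : forall x, mul (idem x) x = x.
Hypothesis idemM : forall x y, idem (mul x y) = mul (idem x) (idem y).
Hypothesis idemK : forall x, idem (idem x) = idem x.
Hypothesis mul_inv : forall x, mul x (inv x) = idem x.

Variables (R : realType) (X : completeNormedModType R[i]) (act : S -> X -> X) (c : R).
Hypothesis act_lin : forall s (l : R[i]) x y,
  act s (l *: x + y) = l *: act s x + act s y.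
Hypothesis actM : forall s t x, act (mul s t) x = act s (act t x).
Hypothesis c_ge1 : 1 <= c.
Hypothesis act_bound : forall s x, nrm (act s x) <= c * nrm x.

Implicit Types f : seq S -> X.
Local Notation cob := (cob mul act).
Local Notation rcob := (rcob mul act).

Lemma sumsB (I : choiceType) (x y : I -> X) l k : sums x l -> sums y k ->
  sums (fun i => x i - y i) (l - k).
Proof.
move=> xl yk; rewrite addrC -scaleN1r; have := sums_lin (-1) yk xl.
by congr (sums _ _); apply/funext => i; rewrite scaleN1r addrC.
Qed.

Lemma sums_rcob (I : choiceType) (f : I -> seq S -> X) g a :
  (forall m, size m = (size a).-1 -> sums (fun k => f k m) (g m)) ->
  sums (fun k => rcob (f k) a) (rcob g a).
Proof.
elim: a f g => [|x [|y l] IHl] f g fg; first exact: sums0.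
  exact: sums_map (act_lin x) (act_bound x) (fg [::] erefl).
rewrite rcob_cons2; apply: sumsB; first exact: fg.
by apply: (IHl (fun k m => f k (x :: m))) => m /= sz_m; apply: fg; rewrite /= sz_m.
Qed.

Lemma sums_cob (I : choiceType) (f : I -> seq S -> X) g a :
  (forall m, size m = (size a).-1 -> sums (fun k => f k m) (g m)) ->
  sums (fun k => cob (f k) a) (cob g a).
Proof.
case: a => [|x l] fg; first exact: sums0.
apply: sumsB; last exact: sums_rcob.
exact: sums_map (act_lin x) (act_bound x) (fg l erefl).
Qed.

Lemma mem_fset_iota k K : (k \in [fset k in iota 0 K]%fset) = (k < K)%N.
Proof. by rewrite !inE mem_iota. Qed.

Lemma big_fset_iota (V : zmodType) (F : nat -> V) K :
  \sum_(k <- [fset k in iota 0 K]%fset) F k = \sum_(k <- iota 0 K) F k.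
Proof.
apply: perm_big; apply: uniq_perm => [||k]; rewrite ?fset_uniq ?iota_uniq //.
by rewrite mem_fset_iota mem_iota.
Qed.

Lemma fsum_exp2_le (A : {fset nat}) : \sum_(k <- A) (2^-1 : R) ^+ k <= 2.
Proof.
pose K := (\max_(k <- A) k).+1.
apply: (@le_trans _ _ (\sum_(k <- [fset k in iota 0 K]%fset) (2^-1 : R) ^+ k)).
  apply: fsum_sub_le; first by move=> k; rewrite exprn_ge0.
    exact: fset_uniq.
  by move=> k kA; rewrite mem_fset_iota ltnS (leq_bigmax_seq (F := id)).
rewrite big_fset_iota.
have -> : \sum_(k <- iota 0 K) (2^-1 : R) ^+ k = 2 - 2 * 2^-1 ^+ K.
  elim: K => [|K IHK]; first by rewrite big_nil expr0 mulr1 subrr.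
  by rewrite -addn1 iotaD big_cat IHK big_seq1 /= add0n addn1 exprS; field.
by rewrite gerBl mulr_ge0 // exprn_ge0.
Qed.

Lemma exp2_small (M0 e : R) : 0 < e -> exists K, M0 * 2^-1 ^+ K <= e.
Proof.
move=> e_gt0; exists (Num.bound (M0 / e)).
set K := Num.bound _.
have [M0_le|M0_gt] := leP M0 0.
  by rewrite (le_trans (mulr_le0_ge0 M0_le _)) ?exprn_ge0 // ltW.
have := archi_boundP (divr_ge0 (ltW M0_gt) (ltW e_gt0)); rewrite -/K => lt_K.
rewrite exprVn ler_pdivrMr ?exprn_gt0 // mulrC -ler_pdivrMr //.
by rewrite (le_trans (ltW lt_K)) // -natrX ler_nat ltnW // ltn_expl.
Qed.

Lemma bounded_coboundary n T M0 : 0 <= M0 ->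
  (forall m, size m = n.+1 -> nrm (T m) <= M0) ->
  (forall a, size a = n.+2 -> cob T a = 0) ->
  exists U M1, [/\ 0 <= M1, forall m, size m = n -> nrm (U m) <= M1 &
    forall a, size a = n.+1 -> cob U a = T a].
Proof.
move=> M0_ge0 TM T_cocycle.
have [C [C_ge0 almost]] := almost_coboundary mulA mulC mul_idem idemM idemK mul_inv
  act_lin actM c_ge1 act_bound n.
pose Mk k : R := M0 * 2^-1 ^+ k.
have Mk_ge0 k : 0 <= Mk k by rewrite mulr_ge0 // exprn_ge0.
(* The hypotheses are placed under the existential so that one choice function covers all pairs of a
   cochain and a stage; its values off cocycles are irrelevant. *)
have /choice[F F_spec] : forall Tk : (seq S -> X) * nat, exists U,
    (forall m, size m = n.+1 -> nrm (Tk.1 m) <= Mk Tk.2) ->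
    (forall a, size a = n.+2 -> cob Tk.1 a = 0) ->
    (forall m, size m = n -> nrm (U m) <= C * Mk Tk.2) /\
    forall a, size a = n.+1 -> nrm (Tk.1 a - cob U a) <= Mk Tk.2.+1.
  move=> [T' k]; have [[T'M T'_cocycle]|no] := pselect
    ((forall m, size m = n.+1 -> nrm (T' m) <= Mk k) /\
     (forall a, size a = n.+2 -> cob T' a = 0)); last first.
    by exists T' => ? ?; case: no.
  have [U [UM U_cob]] := almost T' _ (Mk_ge0 k) T'M T'_cocycle.
  exists U => _ _; split=> // a /U_cob /le_trans; apply.
  by rewrite /Mk exprSr mulrA.
(* Successive remainders: each stage subtracts the coboundary of an approximate primitive and halves
   the norm bound. *)
pose Tk := fix Tk k := if k is k'.+1 then
  fun a => Tk k' a - cob (F (Tk k', k')) a else T.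
have Tk_spec k : (forall m, size m = n.+1 -> nrm (Tk k m) <= Mk k) /\
    (forall a, size a = n.+2 -> cob (Tk k) a = 0).
  elim: k => [|k [IHM IH_cocycle]].
    by split=> // m sz_m; rewrite /Mk expr0 mulr1 TM.
  have [_ F_cob] := F_spec (Tk k, k) IHM IH_cocycle.
  split=> [m sz_m|a sz_a]; first exact: F_cob.
  by rewrite (cobB mul act_lin) IH_cocycle // (cob_cob act_lin mulA mulC actM) subr0.
pose Uk k := F (Tk k, k).
have Uk_bound k m : size m = n -> nrm (Uk k m) <= C * Mk k.
  have [TkM Tk_cocycle] := Tk_spec k.
  by have [UkM _] := F_spec (Tk k, k) TkM Tk_cocycle; apply: UkM.
have Uk_abs m : size m = n -> abs_bounded (fun k => Uk k m) (C * M0 * 2).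
  move=> sz_m A; apply: (@le_trans _ _ (\sum_(k <- A) C * M0 * 2^-1 ^+ k)).
    by apply: ler_sum => k _; rewrite -mulrA Uk_bound.
  by rewrite -mulr_sumr ler_wpM2l ?mulr_ge0 ?fsum_exp2_le.
pose U m := vsum (fun k => Uk k m).
have U_sums m : size m = n -> sums (fun k => Uk k m) (U m).
  by move=> /Uk_abs; apply: sums_complete.
exists U, (C * M0 * 2); split; first by rewrite !mulr_ge0.
  by move=> m sz_m; apply: sums_bound (U_sums m sz_m); apply: Uk_abs.
move=> a sz_a.
have cob_sums : sums (fun k => cob (Uk k) a) (cob U a).
  by apply: sums_cob => m; rewrite sz_a; apply: U_sums.
apply/eqP; rewrite -subr_eq0; apply/eqP/nrm_le0_eq0/ler_addgt0Pr => e e_gt0.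
rewrite add0r.
have e2_gt0 : 0 < e / 2 by rewrite divr_gt0.
have [A A_cob] := cob_sums _ e2_gt0.
have [K1 K1_small] := exp2_small M0 e2_gt0.
(* Large enough for the initial segment below [K] to contain [A] and for the remainder at stage [K]
   to be at most [e / 2]. *)
pose K := maxn K1 (\max_(k <- A) k).+1.
pose B := [fset k in iota 0 K]%fset.
have AB : (A `<=` B)%fset.
  apply/fsubsetP => k kA; rewrite mem_fset_iota leq_max; apply/orP; right.
  by rewrite ltnS (leq_bigmax_seq (F := id)).
have B_sum : \sum_(k <- B) cob (Uk k) a = T a - Tk K a.
  rewrite big_fset_iota.
  elim: {B AB}K => [|K' IHK]; first by rewrite big_nil subrr.
  rewrite -addn1 iotaD big_cat IHK big_seq1 add0n addn1 /=.
  by rewrite opprB addrA addrAC.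
have := A_cob B AB; rewrite B_sum => le1.
have le2 : nrm (Tk K a) <= e / 2.
  have [/(_ a sz_a) TkM _] := Tk_spec K.
  apply: le_trans TkM (le_trans _ K1_small).
  rewrite ler_wpM2l // ler_wiXn2l ?leq_maxl //.
  by rewrite invf_le1 ?ler1n.
have -> : cob U a - T a = - (T a - Tk K a - cob U a) - Tk K a.
  by rewrite !opprB addrA addrAC addrK.
rewrite (le_trans (nrmB _ _)) // nrmN; lra.
Qed.

End Iteration.

(** * Commutative Clifford semigroups *)

Section Semilattice.
Variable L : semilattice.
Implicit Types e f g : L.

Lemma sl_le_refl e : sl_le e e.
Proof. exact: sl_opI. Qed.

Lemma sl_le_trans f e g : sl_le e f -> sl_le f g -> sl_le e g.
Proof. by rewrite /sl_le => <- fg; rewrite sl_opA fg. Qed.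

Lemma sl_le_opl e f : sl_le (sl_op e f) e.
Proof. by rewrite /sl_le sl_opA sl_opI. Qed.

Lemma sl_le_opr e f : sl_le (sl_op e f) f.
Proof. by rewrite sl_opC; apply: sl_le_opl. Qed.

End Semilattice.

Section Clifford.
Variable C : clifford.
Local Notation G := (fun e : cl_L C => g_car (cl_G e)).
Implicit Types (e f g : cl_L C) (s t u : cl_S C).

(** The fibres over propositionally equal indices are different types; [cl_phi f e] serves as the
    transport, being the identity when the indices coincide. *)
Lemma Tagged_eq e f (x : G e) (y : G f) : e = f -> cl_phi f e x = y ->
  Tagged G x = Tagged G y.
Proof. by move=> ef; case: _ / ef y => y; rewrite cl_phi_id => ->. Qed.

(** The image of the unit is idempotent, and a group has only one idempotent. *)
Lemma cl_phi1 f e : sl_le f e -> cl_phi f e (g_one (cl_G e)) = g_one (cl_G f).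
Proof.
move=> fe; set p := cl_phi _ _ _.
have pp : g_mul p p = p by rewrite -cl_phi_hom // g_mul1x.
by rewrite -[LHS]g_mul1x -(g_mulVx p) -g_mulA pp.
Qed.

Definition cl_idem s : cl_S C := Tagged G (g_one (cl_G (tag s))).
Definition cl_inv s : cl_S C := Tagged G (g_inv (tagged s)).

Lemma cl_mulA : associative (@cl_mul C).
Proof.
move=> [e x] [f y] [g z]; rewrite /cl_mul /=.
(* The two products lie over e(fg) and (ef)g. The order facts collected here discharge the side
   conditions for composing structure maps down to (ef)g. *)
have eqA := sl_opA e f g; have leA := sl_le_refl (sl_op (sl_op e f) g).
rewrite -{2}eqA in leA.
have le1 := sl_le_opl e (sl_op f g); have le2 := sl_le_opr e (sl_op f g).
have le3 := sl_le_opl f g; have le4 := sl_le_opr f g.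
have le5 := sl_le_opl (sl_op e f) g; have le6 := sl_le_opr (sl_op e f) g.
have le7 := sl_le_opl e f; have le8 := sl_le_opr e f.
have le9 := sl_le_trans leA le2.
apply: Tagged_eq => //.
by rewrite !cl_phi_hom // !cl_phi_comp // g_mulA.
Qed.

Lemma cl_mul_idem s : cl_mul (cl_idem s) s = s.
Proof.
case: s => e x; rewrite /cl_mul /cl_idem /=.
have eqI := sl_opI e; have le1 := sl_le_opl e e.
have leI : sl_le e (sl_op e e) by rewrite eqI; apply: sl_le_refl.
apply: Tagged_eq => //.
by rewrite cl_phi_hom // !cl_phi_comp // !cl_phi_id g_mul1x.
Qed.

Lemma cl_idemM s t : cl_idem (cl_mul s t) = cl_mul (cl_idem s) (cl_idem t).
Proof.
case: s t => [e x] [f y]; rewrite /cl_mul /cl_idem /=.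
by rewrite !cl_phi1 ?g_mul1x //; [apply: sl_le_opr | apply: sl_le_opl].
Qed.

Lemma cl_idemK s : cl_idem (cl_idem s) = cl_idem s.
Proof. by []. Qed.

Lemma cl_mul_inv s : cl_mul s (cl_inv s) = cl_idem s.
Proof.
case: s => e x; rewrite /cl_mul /cl_idem /cl_inv /=.
have eqI := sl_opI e; have le1 := sl_le_opl e e.
have leI : sl_le e (sl_op e e) by rewrite eqI; apply: sl_le_refl.
apply: Tagged_eq => //.
by rewrite cl_phi_hom // !cl_phi_comp // !cl_phi_id g_mulxV.
Qed.

End Clifford.

(** * Multilinear extension to l^1 *)

Section MultilinearExtension.
Variables (R : realType) (S : choiceType) (X : completeNormedModType R[i]).
Local Notation A := (S -> R[i]).
Implicit Types (f g : seq S -> X) (L : seq A).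

(** The multilinear extension, as an iterated sum with the first variable outermost, so that it
    follows the recursion of [rcob]. *)
Fixpoint ext L f : X :=
  if L is a :: L' then xsum a (fun s => ext L' (fun m => f (s :: m))) else f [::].

Fixpoint l1_seq L : Prop := if L is a :: L' then l1 a /\ l1_seq L' else True.

Lemma l1_seq_cons a L : l1_seq (a :: L) -> l1 a /\ l1_seq L.
Proof. by []. Qed.

Definition bdd_at n f (M : R) := 0 <= M /\ forall m, size m = n -> nrm (f m) <= M.

Lemma bdd_at_cons n f M s : bdd_at n.+1 f M -> bdd_at n (fun m => f (s :: m)) M.
Proof. by move=> [M_ge0 fM]; split=> // m sz_m; rewrite fM //= sz_m. Qed.

Lemma prod_l1norm_ge0 L : l1_seq L -> 0 <= \prod_(a <- L) l1norm a.
Proof.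
elim: L => [|a L IHL]; first by rewrite big_nil.
by move=> [a_l1 /IHL L_ge0]; rewrite big_cons mulr_ge0 ?l1norm_ge0.
Qed.

Lemma ext_bound L f M : l1_seq L -> bdd_at (size L) f M ->
  nrm (ext L f) <= \prod_(a <- L) l1norm a * M.
Proof.
elim: L f => [|a L IHL] f; first by rewrite big_nil mul1r => _ [_]; apply.
move=> [a_l1 L_l1] fM; rewrite big_cons -mulrA; apply: xsum_bound => //.
split=> [|s]; first by rewrite mulr_ge0 ?prod_l1norm_ge0 //; case: fM.
by apply: IHL => //; apply: bdd_at_cons.
Qed.

Lemma ext_bdd L f M : l1_seq L -> bdd_at (size L).+1 f M ->
  bdd (fun s => ext L (fun m => f (s :: m))) (\prod_(a <- L) l1norm a * M).
Proof.
move=> L_l1 fM; split; first by rewrite mulr_ge0 ?prod_l1norm_ge0 //; case: fM.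
by move=> s; apply: ext_bound => //; apply: bdd_at_cons.
Qed.

Lemma eq_ext L f g : (forall m, size m = size L -> f m = g m) -> ext L f = ext L g.
Proof.
elim: L f g => [|a L IHL] f g fg; first exact: fg.
congr xsum; apply/funext => s.
by apply: IHL => m sz_m; rewrite fg //= sz_m.
Qed.

Lemma ext_linr L (l : R[i]) f g M N : l1_seq L -> bdd_at (size L) f M ->
  bdd_at (size L) g N -> ext L (fun m => l *: f m + g m) = l *: ext L f + ext L g.
Proof.
elim: L f g => [//|a L IHL] f g [a_l1 L_l1] fM gN /=.
rewrite -(xsum_linr l a_l1 (ext_bdd L_l1 fM) (ext_bdd L_l1 gN)).
congr xsum; apply/funext => s.
by apply: (IHL (fun m => f (s :: m)) (fun m => g (s :: m))) => //; apply: bdd_at_cons.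
Qed.

Lemma extB L f g M N : l1_seq L -> bdd_at (size L) f M ->
  bdd_at (size L) g N -> ext L (fun m => f m - g m) = ext L f - ext L g.
Proof.
move=> L_l1 fM gN; rewrite addrC -scaleN1r -(ext_linr (-1) L_l1 gN fM).
by apply: eq_ext => m _; rewrite scaleN1r addrC.
Qed.

Lemma ext_map L (phi : X -> X) (c : R) f M :
  (forall (l : R[i]) x y, phi (l *: x + y) = l *: phi x + phi y) ->
  (forall x, nrm (phi x) <= c * nrm x) -> l1_seq L -> bdd_at (size L) f M ->
  phi (ext L f) = ext L (fun m => phi (f m)).
Proof.
move=> phi_lin phi_bound; elim: L f => [//|a L IHL] f [a_l1 L_l1] fM /=.
rewrite (xsum_map phi_lin phi_bound a_l1 (ext_bdd L_l1 fM)).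
congr xsum; apply/funext => s.
by apply: (IHL (fun m => f (s :: m))) => //; apply: bdd_at_cons.
Qed.

Lemma ext_slot L1 L2 (l : R[i]) a b f M : l1_seq L1 -> l1_seq L2 -> l1 a -> l1 b ->
  bdd_at (size L1 + size L2).+1 f M ->
  ext (L1 ++ (fun s => l * a s + b s) :: L2) f =
    l *: ext (L1 ++ a :: L2) f + ext (L1 ++ b :: L2) f.
Proof.
move=> + L2_l1 a_l1 b_l1; elim: L1 f => [|d L1 IHL1] f /=.
  by move=> _ fM; apply: xsum_linl => //; apply: ext_bdd fM.
move=> [d_l1 L1_l1] fM.
have cat_l1 z : l1 z -> l1_seq (L1 ++ z :: L2).
  by move=> z_l1; elim: L1 L1_l1 {IHL1 fM} => //= ? ? IH [? /IH].
have f_bdd z : bdd_at (size (L1 ++ z :: L2)).+1 f M.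
  by rewrite size_cat /= addnS.
rewrite -(xsum_linr l d_l1 (ext_bdd (cat_l1 _ a_l1) (f_bdd a))
                           (ext_bdd (cat_l1 _ b_l1) (f_bdd b))).
congr xsum; apply/funext => s.
by apply: (IHL1 (fun m => f (s :: m))) => //; apply: bdd_at_cons.
Qed.

Variables (mul : S -> S -> S) (actl : A -> X -> X) (c : R).
Hypothesis actl_linr : forall a, l1 a -> forall (l : R[i]) x y,
  actl a (l *: x + y) = l *: actl a x + actl a y.
Hypothesis actl_linl : forall x (l : R[i]) a b, l1 a -> l1 b ->
  actl (fun s => l * a s + b s) x = l *: actl a x + actl b x.
Hypothesis actl_bound : forall a x, l1 a -> nrm (actl a x) <= c * l1norm a * nrm x.
Hypothesis c_ge1 : 1 <= c.

Local Notation conv := (@Defs.conv R S mul).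
Let act s x := actl (delta R s) x.

Let act_bound s x : nrm (act s x) <= c * nrm x.
Proof.
rewrite (le_trans (actl_bound x (l1_delta R s))) // -mulrA ler_wpM2l //.
  by rewrite (le_trans ler01).
by rewrite ler_piMl ?nrm_ge0 // l1norm_delta.
Qed.

Lemma actl_xsum a x : l1 a -> actl a x = xsum a (fun s => act s x).
Proof.
apply: (l1_linear_xsum (phi := fun a => actl a x) (c := c * nrm x)).
  by move=> l b d; apply: actl_linl.
by move=> b b_l1; rewrite mulrAC actl_bound.
Qed.

Lemma rcob_bdd (G : S -> seq A -> X) L :
  (forall L', l1_seq L' -> exists M, bdd (fun s => G s L') M) -> l1_seq L ->
  exists M, bdd (fun s => rcob conv actl (G s) L) M.
Proof.
elim: L G => [|a [|b L] IHL] G GM L_l1.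
- by exists 0; split=> // s; rewrite nrm0.
- have [M [M_ge0 MG]] := GM [::] I; have [a_l1 _] := L_l1.
  have ca_ge0 : 0 <= c * l1norm a by rewrite mulr_ge0 ?l1norm_ge0 ?(le_trans ler01).
  exists (c * l1norm a * M); split=> [|s]; first exact: mulr_ge0.
  by rewrite (le_trans (actl_bound _ _)) // ler_wpM2l.
have [a_l1 bL_l1] := l1_seq_cons L_l1; have [b_l1 L_l1'] := l1_seq_cons bL_l1.
have [M [M_ge0 MG]] := GM (conv a b :: L) (conj (l1_conv mul a_l1 b_l1) L_l1').
have [|N [N_ge0 NG]] := IHL (fun s L' => G s (a :: L')) _ bL_l1.
  by move=> L' L'_l1; apply: GM.
exists (M + N); split=> [|s]; first exact: addr_ge0.
by rewrite rcob_cons2 (le_trans (nrmB _ _)) // lerD.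
Qed.

(** Every face is bounded linear in the coefficient, so the sum over a frozen variable passes
    through; the bounds uniform in [s] make each sum converge. *)
Lemma rcob_xsum (G : S -> seq A -> X) a L : l1 a ->
  (forall L', l1_seq L' -> exists M, bdd (fun s => G s L') M) -> l1_seq L ->
  rcob conv actl (fun L' => xsum a (fun s => G s L')) L =
    xsum a (fun s => rcob conv actl (G s) L).
Proof.
move=> a_l1; elim: L G => [|y [|z L] IHL] G GM L_l1.
- by apply/esym/vsumE; under eq_fun do rewrite scaler0; apply: sums0.
- have [M MG] := GM [::] I; have [y_l1 _] := L_l1.
  apply: (xsum_map (actl_linr y_l1) _ a_l1 MG) => x.
  exact: actl_bound.
have [y_l1 zL_l1] := l1_seq_cons L_l1; have [z_l1 L_l1'] := l1_seq_cons zL_l1.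
have [M MG] := GM (conv y z :: L) (conj (l1_conv mul y_l1 z_l1) L_l1').
have GyM L' : l1_seq L' -> exists M, bdd (fun s => G s (y :: L')) M.
  by move=> L'_l1; apply: GM.
have [N NG] := rcob_bdd GyM zL_l1.
rewrite rcob_cons2 (IHL (fun s L' => G s (y :: L'))) //.
by rewrite -(xsumB a_l1 MG NG).
Qed.

Lemma nrm_rcob_at f M n : bdd_at n f M ->
  bdd_at n.+1 (rcob mul act f) (n.+1%:R * (c * M)).
Proof.
move=> [M_ge0 fM]; have c_ge0 : 0 <= c by rewrite (le_trans ler01).
split=> [|m sz_m]; first by rewrite !mulr_ge0.
rewrite -sz_m; apply: nrm_rcob => // m' m'm; apply: fM.
have : m' \in faces mul m by case: m m'm {sz_m} => //= x l; rewrite inE orbC => ->.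
by move=> /size_faces ->; rewrite sz_m.
Qed.

(** The merging face becomes a convolution by [xsum_conv]; the later faces follow by induction with
    the first variable frozen, using [rcob_xsum]. *)
Lemma ext_rcob L f M : l1_seq L -> (forall n, bdd_at n f M) ->
  ext L (rcob mul act f) = rcob conv actl (fun L' => ext L' f) L.
Proof.
elim: L f => [//|a [|b L] IHL] f L_l1 fM.
  by have [a_l1 _] := L_l1; rewrite /= actl_xsum.
have [a_l1 bL_l1] := l1_seq_cons L_l1; have [b_l1 L_l1'] := l1_seq_cons bL_l1.
have fsM s n : bdd_at n (fun m => f (s :: m)) M by apply: bdd_at_cons.
pose V w := ext L (fun m => f (w :: m)).
have V_bdd : bdd V _ := ext_bdd L_l1' (fM _).
(* With the first variable frozen at [s], [P] is the face merging the first two arguments and [Q]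
   gathers the later ones. *)
pose P s := xsum b (fun t => V (mul s t)).
pose Q s := ext (b :: L) (rcob mul act (fun m => f (s :: m))).
have rf_bdd s := nrm_rcob_at (fsM s (size L)).
have P_bdd : bdd P (l1norm b * (\prod_(d <- L) l1norm d * M)).
  have [V_ge0 VM] := V_bdd; split=> [|s]; first by rewrite mulr_ge0 ?l1norm_ge0.
  by apply: xsum_bound => //; split=> // t; apply: VM.
have Q_bdd : bdd Q (\prod_(d <- b :: L) l1norm d * ((size L).+1%:R * (c * M))).
  have c_ge0 : 0 <= c by rewrite (le_trans ler01).
  have [M_ge0 _] := fM 0; split=> [|s].
    by rewrite mulr_ge0 ?prod_l1norm_ge0 // !mulr_ge0.
  exact: ext_bound.
have -> : ext [:: a, b & L] (rcob mul act f) = xsum a (fun s => P s - Q s).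
  rewrite [LHS]/(xsum a (fun s => ext (b :: L) (fun m => rcob mul act f (s :: m)))).
  congr xsum; apply/funext => s.
  pose g m := if m is t :: m' then f (mul s t :: m') else 0.
  rewrite -[P s]/(ext (b :: L) g) /Q.
  have g_bdd : bdd_at (size (b :: L)) g M.
    have [M_ge0 _] := fM 0; split=> // -[//|t m] /= sz_m.
    by have [_] := fM (size L).+1; apply; rewrite -sz_m.
  rewrite -(extB bL_l1 g_bdd (rf_bdd s)).
  by apply: eq_ext => -[//|t m] _; rewrite rcob_cons2.
rewrite (xsumB a_l1 P_bdd Q_bdd) rcob_cons2 -(xsum_conv mul a_l1 b_l1 V_bdd).
congr (_ - _).
rewrite (rcob_xsum (G := fun s L' => ext L' (fun m => f (s :: m))) a_l1 _ bL_l1).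
  congr xsum; apply/funext => s; exact: (IHL (fun m => f (s :: m))).
by move=> L' L'_l1; eexists; apply: ext_bdd => //; apply: fM.
Qed.

Lemma ext_cob L f M : l1_seq L -> (forall n, bdd_at n f M) ->
  ext L (cob mul act f) = cob conv actl (fun L' => ext L' f) L.
Proof.
case: L => [//|a L] L_l1 fM; rewrite /cob -(ext_rcob L_l1 fM).
have [a_l1 L_l1'] := l1_seq_cons L_l1; have c_ge0 : 0 <= c by rewrite (le_trans ler01).
pose g m := if m is s :: m' then act s (f m') else 0.
have g_bdd : bdd_at (size (a :: L)) g (c * M).
  have [M_ge0 fM'] := fM (size L); split=> [|[//|s m] /= [sz_m]]; first exact: mulr_ge0.
  by rewrite (le_trans (act_bound _ _)) // ler_wpM2l // fM'.
have -> : actl a (ext L f) = ext (a :: L) g.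
  rewrite actl_xsum //; congr xsum; apply/funext => s.
  exact: ext_map (actl_linr (l1_delta R s)) (act_bound s) L_l1' (fM _).
rewrite -(extB L_l1 g_bdd (nrm_rcob_at (fM (size L)))).
by apply: eq_ext => -[].
Qed.

End MultilinearExtension.

(** * Translation between arguments indexed by ordinals and sequences *)

Section Arguments.
Variables (R : realType) (S : choiceType) (X : completeNormedModType R[i]).
Variables (mul : S -> S -> S) (actl : (S -> R[i]) -> X -> X) (actr : X -> (S -> R[i]) -> X).
Local Notation A := (S -> R[i]).
Local Notation conv := (@Defs.conv R S mul).

Definition arg_seq n (a : 'I_n -> A) : seq A := [seq a i | i <- enum 'I_n].

Lemma arg_seqS n (a : 'I_n.+1 -> A) :
  arg_seq a = a ord0 :: arg_seq (args_tail a).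
Proof. by rewrite /arg_seq enum_ordSl /= -map_comp. Qed.

Lemma size_arg_seq n (a : 'I_n -> A) : size (arg_seq a) = n.
Proof. by rewrite size_map size_enum_ord. Qed.

Lemma nth_arg_seq n (a : 'I_n -> A) (i : 'I_n) : nth (fun=> 0) (arg_seq a) i = a i.
Proof. by rewrite (nth_map i) ?size_enum_ord // nth_ord_enum. Qed.

Lemma arg_seq_nth n L : size L = n ->
  arg_seq (fun i : 'I_n => nth (fun=> 0) L i) = L.
Proof.
move=> sz_L; apply: (@eq_from_nth _ (fun=> 0)) => [|i]; rewrite size_arg_seq ?sz_L //.
by move=> i_n; rewrite (nth_arg_seq _ (Ordinal i_n)).
Qed.

Lemma l1_arg_seq n (a : 'I_n -> A) : l1_args a -> l1_seq (arg_seq a).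
Proof.
elim: n a => [|n IHn] a a_l1; first by rewrite /arg_seq enum_ord0.
by rewrite arg_seqS; split; [exact: a_l1 | apply: IHn => i; apply: a_l1].
Qed.

Lemma prod_arg_seq n (a : 'I_n -> A) :
  \prod_(b <- arg_seq a) l1norm b = \prod_(i < n) l1norm (a i).
Proof. by rewrite big_map big_enum. Qed.

Let merge0 n (a : 'I_n.+2 -> A) : arg_seq (args_merge mul a 0) =
  conv (a ord0) (args_tail a ord0) :: arg_seq (args_tail (args_tail a)).
Proof.
rewrite arg_seqS; congr (_ :: _).
  rewrite /args_merge /= /args_tail; congr conv; congr a; apply: val_inj.
    by rewrite /= inordK.
  by rewrite /= inordK.
congr arg_seq; apply/funext => j; rewrite /args_tail /args_merge /=.
by congr a; apply: val_inj; rewrite /= inordK //= !ltnS.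
Qed.

Let mergeS n (a : 'I_n.+2 -> A) i : (i < n)%N ->
  arg_seq (args_merge mul a i.+1) = a ord0 :: arg_seq (args_merge mul (args_tail a) i).
Proof.
move=> i_n; rewrite arg_seqS; congr (_ :: _).
  by rewrite /args_merge /=; congr a; apply: val_inj; rewrite /= inordK.
have tail_inord k : (k < n.+1)%N -> args_tail a (inord k) = a (inord k.+1).
  by move=> k_n; rewrite /args_tail; congr a; apply: val_inj; rewrite /= !inordK.
congr arg_seq; apply/funext => j; rewrite {1}/args_tail /args_merge /= /bump /= add1n.
have j_n := ltn_ord j.
by rewrite ltnS eqSS !tail_inord ?ltnS // ltnW.
Qed.

(** Symmetry converts the right action of the last face into the left action built into [cob]. *)
Lemma coboundary_cob n (F : seq A -> X) (a : 'I_n.+1 -> A) :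
  (forall b x, l1 b -> actl b x = actr x b) -> l1_args a ->
  coboundary mul actl actr (fun b : 'I_n -> A => F (arg_seq b)) a =
    cob conv actl F (arg_seq a).
Proof.
move=> sym a_l1.
(* Stated for all [G] because the induction passes to partial applications; shifting by one position
   reverses every sign. *)
have rcobE k (G : seq A -> X) (b : 'I_k.+1 -> A) : l1_args b ->
    - rcob conv actl G (arg_seq b) =
    \sum_(i < k) (-1) ^+ i.+1 *: G (arg_seq (args_merge mul b i))
      + (-1) ^+ k.+1 *: actr (G (arg_seq (args_init b))) (b ord_max).
  elim: k G b => [|k IHk] G b b_l1.
    rewrite big_ord0 add0r expr1 scaleN1r; congr (- _).
    rewrite arg_seqS [arg_seq (args_init b)]/arg_seq [arg_seq (args_tail b)]/arg_seq.
    rewrite !enum_ord0 /= sym //; congr (actr _ (b _)).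
    exact: val_inj.
  have initS : arg_seq (args_init b) = b ord0 :: arg_seq (args_init (args_tail b)).
    rewrite arg_seqS; congr (_ :: _); first by congr b; apply: val_inj.
    by congr arg_seq; apply/funext => j; congr b; apply: val_inj.
  have last_tail : b ord_max = args_tail b ord_max by congr b; apply: val_inj.
  rewrite big_ord_recl merge0 initS last_tail expr1 scaleN1r.
  have -> : arg_seq b =
      [:: b ord0, args_tail b ord0 & arg_seq (args_tail (args_tail b))].
    by rewrite !arg_seqS.
  rewrite rcob_cons2 -arg_seqS opprB addrC -addrA; congr (_ + _).
  rewrite -[LHS]opprK IHk; last by move=> i; apply: b_l1.
  rewrite opprD -sumrN; congr (_ + _).
    apply: eq_bigr => i _.
    by rewrite lift0 mergeS // [in RHS]exprS mulN1r scaleNr.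
  by rewrite [in RHS]exprS mulN1r scaleNr.
rewrite /coboundary -addrA -rcobE //.
by rewrite [in RHS]arg_seqS /cob -arg_seqS.
Qed.

(** Arguments are expanded over point masses from left to right by [l1_linear_xsum]; [p] is the
    prefix already replaced. *)
Lemma cochain_ext n (T : ('I_n -> A) -> X) (p : seq S) L : cochain T ->
  (size p + size L)%N = n -> l1_seq L ->
  T (fun i => nth (fun=> 0) (map (@delta R S) p ++ L) i) =
  ext L (fun m => T (fun i => nth (fun=> 0) (map (@delta R S) (p ++ m)) i)).
Proof.
move=> [T_lin [c T_bound]]; elim: L p => [|a L IHL] p sz_pL L_l1; first by rewrite /= !cats0.
have [a_l1 {}L_l1] := l1_seq_cons L_l1.
pose args z : 'I_n -> A := fun i => nth (fun=> 0) (map (@delta R S) p ++ z :: L) i.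
have args_l1 z : l1 z -> l1_args (args z).
  move=> z_l1 i; rewrite /args.
  have: l1_seq (map (@delta R S) p ++ z :: L).
    elim: p {sz_pL IHL args} => //= s p IHp; split=> //; exact: l1_delta.
  elim: (_ ++ _) (nat_of_ord i) => [|d l IHl] [|k] //=; try by move=> _; apply: l1_0.
    by case.
  by case=> _ /IHl.
have p_n : (size p < n)%N by rewrite -sz_pL -addSnnS leq_addr.
pose k := Ordinal p_n.
have argsE z z' : args z' = fun j => if j == k then z' else args z j.
  apply/funext => j; rewrite /args !nth_cat size_map -val_eqE /=.
  case: ltngtP => [//|pj|->]; last by rewrite subnn.
  by case: (j - size p)%N (subn_gt0 (size p) j) => //=; rewrite pj.
have argsk z : args z k = z by rewrite (argsE z z) eqxx.
have T_le z : l1_args z -> nrm (T z) <= c * \prod_(i < n) l1norm (z i).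
  by move=> /T_bound; rewrite nrmE lecR.
(* The norms of the fixed arguments enter the constant for slot [k]. That slot is excluded from the
   product, so its filler [0] does not matter. *)
pose D := \prod_(i < n | i != k) l1norm (args (fun=> 0) i).
rewrite -[LHS]/(T (args a)).
rewrite (l1_linear_xsum (phi := fun z => T (args z)) (c := c * D)) //.
- congr xsum; apply/funext => s.
  rewrite -[RHS](eq_ext (f := fun m => T (fun i : 'I_n =>
      nth (fun=> 0) (map (@delta R S) (rcons p s ++ m)) i))); last first.
    by move=> m _; rewrite cat_rcons.
  by rewrite -IHL ?size_rcons ?addSnnS // map_rcons cat_rcons.
- move=> l z z' z_l1 z'_l1.
  have := T_lin (args z) k z' l (args_l1 z z_l1) z'_l1.
  by rewrite argsk -!argsE.
- move=> z z_l1; rewrite (le_trans (T_le _ (args_l1 z z_l1))) //.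
  rewrite (bigD1 k) //= argsk mulrCA mulrC -!mulrA.
  rewrite le_eqVlt; apply/orP; left; apply/eqP; congr (_ * (_ * _)).
  by apply: eq_bigr => i ik; rewrite (argsE (fun=> 0) z) (negPf ik).
Qed.

End Arguments.

(** [L1] and [L2] are chosen before [z], so one decomposition serves all three tuples in the
    linearity condition. *)
Lemma arg_seq_update (R : realType) (S : choiceType) n (a : 'I_n -> S -> R[i]) i :
  l1_args a -> exists L1 L2, [/\ l1_seq L1, l1_seq L2, (size L1 + size L2).+1 = n &
    forall z, arg_seq (fun j => if j == i then z else a j) = L1 ++ z :: L2].
Proof.
elim: n a i => [|n IHn] a i a_l1; first by case: i.
have tail_l1 : l1_args (args_tail a) by move=> j; apply: a_l1.
case: (unliftP ord0 i) => [k|] ->.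
  have [L1 [L2 [L1_l1 L2_l1 sz_L LE]]] := IHn _ k tail_l1.
  exists (a ord0 :: L1), L2; split=> //=; first by rewrite addSn sz_L.
  by move=> z; rewrite arg_seqS /= -LE; congr (_ :: arg_seq _).
exists [::], (arg_seq (args_tail a)); split=> //.
- exact: l1_arg_seq.
- by rewrite size_arg_seq.
by move=> z; rewrite arg_seqS /=; congr (_ :: arg_seq _).
Qed.

Theorem theorem7p3 (R : realType) (C : clifford) (X : completeNormedModType R[i])
  (actl : (cl_S C -> R[i]) -> X -> X) (actr : X -> (cl_S C -> R[i]) -> X) :
  cl_commutative C ->
  banach_bimodule (@cl_mul C) actl actr ->
  symmetric_bimodule actl actr ->
  forall n : nat, (1 <= n)%N -> hochschild_vanishes (@cl_mul C) actl actr n.-1.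
Proof.
move=> mulC [actlM _ _ [act_linr act_linl [c0 act_bd]]] sym [//|n] _ T T_cochain T_cocycle.
pose mul := @cl_mul C; pose dl := @delta R (cl_S C).
(* The module constant is enlarged to be at least 1, as the face estimates require. *)
pose c : R := `|c0| + 1.
have c_ge1 : 1 <= c by rewrite lerDr.
have symm a x : l1 a -> actl a x = actr x a by apply: sym.
have actl_linr a : l1 a -> forall (l : R[i]) x y,
    actl a (l *: x + y) = l *: actl a x + actl a y.
  by move=> a_l1 l x y; have [] := act_linr a a_l1 l x y.
have actl_linl x (l : R[i]) a b : l1 a -> l1 b ->
    actl (fun s => l * a s + b s) x = l *: actl a x + actl b x.
  by move=> a_l1 b_l1; have [] := act_linl x l a b a_l1 b_l1.
have actl_bound a x : l1 a -> nrm (actl a x) <= c * l1norm a * nrm x.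
  move=> a_l1; have [+ _] := act_bd a x a_l1; rewrite !nrmE -rmorphM /= lecR.
  move=> /le_trans; apply; rewrite ler_wpM2r ?nrm_ge0 // ler_wpM2r ?l1norm_ge0 //.
  by rewrite (le_trans (ler_norm c0)) // lerDl.
pose act s x := actl (dl s) x.
have act_lin s (l : R[i]) x y : act s (l *: x + y) = l *: act s x + act s y.
  by apply: actl_linr; apply: l1_delta.
have actM s t x : act (mul s t) x = act s (act t x).
  by rewrite /act -actlM ?conv_delta //; apply: l1_delta.
have act_bound s x : nrm (act s x) <= c * nrm x.
  rewrite (le_trans (actl_bound _ x (l1_delta R s))) // ler_wpM2r ?nrm_ge0 //.
  by rewrite ler_piMr ?l1norm_delta // (le_trans ler01).
have [T_lin [cT T_bound]] := T_cochain.
pose F L := T (fun i : 'I_n.+1 => nth (fun=> 0) L i).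
have F_arg b : F (arg_seq b) = T b.
  by rewrite /F; congr T; apply/funext => i; apply: nth_arg_seq.
pose t p := F (map dl p).
have nth_dl (p : seq (cl_S C)) k : l1 (nth (fun=> 0) (map dl p) k) /\
    l1norm (nth (fun=> 0) (map dl p) k) <= 1.
  elim: p k => [|s p IHp] [|k] //=; try by rewrite l1norm0; split; first exact: l1_0.
  by split; [apply: l1_delta | apply: l1norm_delta].
(* The bound holds at every length: entries beyond [p] are padded with [0], and those beyond n + 1
   are ignored. *)
have t_bound p : nrm (t p) <= `|cT|.
  have := T_bound (fun i => nth (fun=> 0) (map dl p) i) (fun i => (nth_dl p i).1).
  rewrite nrmE lecR => /le_trans; apply.
  have prod_ge0 : 0 <= \prod_(i < n.+1) l1norm (nth (fun=> 0) (map dl p) i).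
    by apply: prodr_ge0 => i _; apply: l1norm_ge0; case: (nth_dl p i).
  apply: (@le_trans _ _ (`|cT| * \prod_(i < n.+1) l1norm (nth (fun=> 0) (map dl p) i))).
    by rewrite ler_wpM2r // ler_norm.
  rewrite ler_piMr //; apply: prodr_ile1 => i _.
  by have [dl_l1 ->] := nth_dl p i; rewrite l1norm_ge0.
have t_cocycle a : size a = n.+2 -> cob mul act t a = 0.
  move=> sz_a.
  rewrite (cob_map (mulT := Defs.conv mul) (actT := actl) (h := dl) _ _ F) //; last first.
    by move=> s s'; rewrite conv_delta.
  have sz_da : size (map dl a) = n.+2 by rewrite size_map.
  have b_l1 : l1_args (fun i : 'I_n.+2 => nth (fun=> 0) (map dl a) i).
    by move=> i; case: (nth_dl a i).
  rewrite -(arg_seq_nth sz_da) -(coboundary_cob mul F symm b_l1) -(T_cocycle _ b_l1).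
  by congr coboundary; apply/funext => b; apply: F_arg.
have [u [M1 [M1_ge0 u_bound u_cob]]] := bounded_coboundary (@cl_mulA C) mulC
  (@cl_mul_idem C) (@cl_idemM C) (@cl_idemK C) (@cl_mul_inv C) act_lin actM c_ge1
  act_bound (normr_ge0 cT) (fun m _ => t_bound m) t_cocycle.
(* [u] is controlled at length n only, whereas [ext_cob] wants a bound at every length; cutting it
   off elsewhere leaves the relevant coboundary unchanged. *)
pose u' m := if size m == n then u m else 0.
have u'_bdd k : bdd_at k u' M1.
  split=> // m _; rewrite /u'; case: eqP => [/u_bound//|_].
  by rewrite nrm0.
exists (fun b => ext (arg_seq b) u'); split.
  split=> [a i b l a_l1 b_l1|].
    have [L1 [L2 [L1_l1 L2_l1 sz_L LE]]] := arg_seq_update i a_l1.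
    have aE : arg_seq a = L1 ++ a i :: L2.
      by rewrite -LE; congr arg_seq; apply/funext => j; case: eqP => // ->.
    by rewrite !LE aE (ext_slot l L1_l1 L2_l1 (a_l1 i) b_l1 (u'_bdd _)).
  exists M1 => a a_l1; rewrite nrmE lecR mulrC -prod_arg_seq.
  by apply: ext_bound => //; apply: l1_arg_seq.
move=> a a_l1; have La_l1 := l1_arg_seq a_l1.
rewrite (coboundary_cob mul (fun L => ext L u') symm a_l1).
rewrite -(ext_cob mul actl_linr actl_linl actl_bound c_ge1 La_l1 u'_bdd).
(* It remains to compare on point masses: there [cob u'] agrees with [t], and [cochain_ext] with
   empty prefix identifies the extension of [t] with [T]. *)
rewrite (eq_ext (g := t)) => [|m].
  have := cochain_ext (p := [::]) T_cochain (size_arg_seq a) La_l1.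
  by rewrite -[LHS]/(F (arg_seq a)) F_arg => ->.
rewrite size_arg_seq => sz_m; rewrite -u_cob //; apply: eq_cob => m'.
by rewrite sz_m /u' => ->; rewrite eqxx.
Qed.
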